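(* Let $\boldsymbol{k}=(k_1,\dots,k_r)$ be an index with $k_1,k_r\geqslant2$. Then, for $s\in\mathbb C\setminus\mathbb Z$, $$\mathcal T(\boldsymbol{k};s)=\sum_{j=1}^{r}\sum_{m=0}^{k_j-2}C_{j,m}^0(\boldsymbol{k})\,\mathcal T(k_j-m;s),$$ where $$C_{j,m}^0(\boldsymbol{k})=\sum_{\substack{a+b=m\\ a,b\geqslant0}}(-1)^{|\boldsymbol{k}_{[1,j)}|+a}\,\zeta_{*,a}^0\bigl(\overleftarrow{\boldsymbol{k}_{[1,j)}}\bigr)\,\zeta_{*,b}^0\bigl(\boldsymbol{k}_{(j,r]}\bigr).$$ All multiple zeta values occurring here are convergent (i.e. the indices occurring are admissible), and the coefficients are independent of $T$ (i.e. replacing the regularization parameter $0$ by any $T$ does not change them).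
   Context: An index is a finite sequence $\boldsymbol{k}=(k_1,\dots,k_r)$ of positive integers, of weight $|\boldsymbol{k}|=k_1+\cdots+k_r$; the empty index is $\varnothing$ (weight $0$). Reversal: $\overleftarrow{\boldsymbol{k}}=(k_r,\dots,k_1)$. Write $\boldsymbol{k}_{(j,r]}=(k_{j+1},\dots,k_r)$, $\boldsymbol{k}_{[1,j)}=(k_1,\dots,k_{j-1})$, with $\boldsymbol{k}_{(r,r]}=\boldsymbol{k}_{[1,1)}=\varnothing$. An index is admissible if it is empty or its last entry is $\geqslant2$. For $k_1,k_r\geqslant2$, $\mathcal T(\boldsymbol{k};s)=\sum_{-\infty<n_1<\cdots<n_r<\infty}\prod_{i=1}^r(n_i+s)^{-k_i}$ (absolutely convergent for $s\in\mathbb C\setminus\mathbb Z$); in particular $\mathcal T(k;s)=\sum_{n\in\mathbb Z}(n+s)^{-k}$ for $k\geqslant2$. Stuffle-regularized multiple zeta values. For a nonempty admissible index $\boldsymbol{a}=(a_1,\dots,a_d)$, $\zeta(\boldsymbol{a})=\sum_{0<n_1<\cdots<n_d}\prod_{i}n_i^{-a_i}$, and $\zeta(\varnothing)=1$. On the $\mathbb Q$-span of all indices, the stuffle product $*$ is bilinear with unit $\varnothing$ and $(a,\boldsymbol{\alpha})*(b,\boldsymbol{\beta})=(a,\boldsymbol{\alpha}*(b,\boldsymbol{\beta}))+(b,(a,\boldsymbol{\alpha})*\boldsymbol{\beta})+(a+b,\boldsymbol{\alpha}*\boldsymbol{\beta})$. It is known that every index of depth $r$ has a unique decomposition $\boldsymbol{k}=\sum_{l=0}^r\boldsymbol{u}_l*(1)^{*l}$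 with each $\boldsymbol{u}_l$ in the span of admissible indices. Define $\zeta_*^T(\boldsymbol{k})=\sum_{l=0}^r\zeta(\boldsymbol{u}_l)T^l$ (with $\zeta$ extended linearly; thus $\zeta_*^T(\boldsymbol{k})=\zeta(\boldsymbol{k})$ for admissible $\boldsymbol{k}$), and, for $m\geqslant0$, $$\zeta_{*,m}^T(\boldsymbol{k})=\sum_{\substack{\lambda_1+\cdots+\lambda_r=m\\ \lambda_\nu\geqslant0}}\Bigl(\prod_{\nu=1}^r\tbinom{-k_\nu}{\lambda_\nu}\Bigr)\zeta_*^T(k_1+\lambda_1,\dots,k_r+\lambda_r),\qquad \zeta_{*,m}^T(\varnothing)=\delta_{m,0}.$$ *)

(* Defs.v *)
From mathcomp Require Import all_boot all_order all_algebra.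
From mathcomp Require Export finmap.
From mathcomp Require Export complex monalg.
From mathcomp Require Export boolp classical_sets functions reals ereal.
From mathcomp Require Export numfun esum.

Set Implicit Arguments.
Unset Strict Implicit.
Unset Printing Implicit Defensive.

Import Order.TTheory GRing.Theory Num.Theory.
Local Open Scope classical_set_scope.
Local Open Scope ring_scope.

(* Entries of an index are numbered from 0, so the paper's k_j is
   nth 0 k (j - 1), and for a 0-based position j the subindices strictly before
   and strictly after it are take j k and drop j.+1 k. *)
Definition is_index (k : seq nat) : bool := all (leq 1) k.

Definition weight (k : seq nat) : nat := sumn k.

Definition admissible (k : seq nat) : bool :=
  is_index k && ((k == [::]) || (2 <= last 0 k)%N).

(* Sums of absolutely convergent real or complex families, with no order of
   summation; the value is meaningless for other families. *)
Section Sums.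
Context {R : realType} {I : choiceType}.

Definition rsum (D : set I) (f : I -> R) : R :=
  fine (\esum_(i in D) (EFin \o f)^\+ i - \esum_(i in D) (EFin \o f)^\- i)%E.

Definition csum (D : set I) (f : I -> R[i]) : R[i] :=
  Complex (rsum D (fun i => complex.Re (f i)))
          (rsum D (fun i => complex.Im (f i))).

End Sums.

Section MultitangentAndZeta.
Context {R : realType}.

Definition multitangent (k : seq nat) (s : R[i]) : R[i] :=
  csum [set n : (size k).-tuple int | sorted <%R n]
    (fun n => \prod_(i < size k) ((tnth n i)%:~R + s) ^- nth 0%N k i).

(* The domain is 0 < n_1 < ... < n_d; for the empty index it consists of the
   empty tuple only, so that the sum is the empty product 1. *)
Definition mzv_sum (a : seq nat) : \bar R :=
  \esum_(n in [set n : (size a).-tuple nat | sorted ltn (0%N :: n)])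
    (\prod_(i < size a) (tnth n i)%:R ^- nth 0%N a i)%:E.

Definition mzv_convergent (a : seq nat) : Prop := (mzv_sum a < +oo)%E.

Definition mzv (a : seq nat) : R := fine (mzv_sum a).

End MultitangentAndZeta.

(* The Q-span of all words; those with entries >= 1 are the indices. *)
Notation index_span := {malg rat[seq nat]}.

(* The stuffle product of two words as the list, with multiplicities, of the
   words whose sum it is. *)
Fixpoint stuffle_words (u : seq nat) : seq nat -> seq (seq nat) :=
  if u is a :: u' then
    fix stuffle_u (v : seq nat) : seq (seq nat) :=
      if v is b :: v' then
        map (cons a) (stuffle_words u' v) ++ map (cons b) (stuffle_u v')
        ++ map (cons (a + b)%N) (stuffle_words u' v')
      else [:: u]
  else fun v => [:: v].

Definition stuffle (x y : index_span) : index_span :=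
  \sum_(u <- msupp x) \sum_(v <- msupp y)
    (x@_u * y@_v) *: \sum_(w <- stuffle_words u v) (<< w >> : index_span).

Definition stuffle_pow (x : index_span) (l : nat) : index_span :=
  iter l (stuffle x) << [::] >>.

Definition admissible_span (x : index_span) : Prop :=
  forall w : seq nat, w \in msupp x -> admissible w.

Definition is_reg_decomp (k : seq nat) (u : {ffun 'I_(size k).+1 -> index_span}) :
    Prop :=
  (forall l, admissible_span (u l)) /\
  << k >> = \sum_(l < (size k).+1) stuffle (u l) (stuffle_pow << [:: 1%N] >> l).

(* The decomposition exists and is unique for every index k. *)
Definition reg_decomp (k : seq nat) : {ffun 'I_(size k).+1 -> index_span} :=
  xget [ffun=> 0] [set u | @is_reg_decomp k u].

(* Compositions of m into r parts >= 0; each part is automatically <= m. *)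
Definition is_composition (m r : nat) (lam : r.-tuple 'I_m.+1) : bool :=
  (\sum_(i < r) tnth lam i == m)%N.

Definition shift_index (m : nat) (k : seq nat)
    (lam : (size k).-tuple 'I_m.+1) : seq nat :=
  [seq (p.1 + val p.2)%N | p <- zip k lam].

Definition gbinom {F : fieldType} (x : F) (n : nat) : F :=
  (\prod_(i < n) (x - i%:R)) / n`!%:R.

Section Regularized.
Context {R : realType}.
Local Open Scope complex_scope.

Definition mzv_span (x : index_span) : R :=
  \sum_(w <- msupp x) ratr x@_w * mzv w.

Definition mzv_reg (T : R[i]) (k : seq nat) : R[i] :=
  \sum_(l < (size k).+1) (mzv_span (reg_decomp k l))%:C * T ^+ l.

Definition mzv_reg_shift (T : R[i]) (m : nat) (k : seq nat) : R[i] :=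
  \sum_(lam : (size k).-tuple 'I_m.+1 | is_composition lam)
    (\prod_(i < size k) gbinom (- (nth 0%N k i)%:R) (tnth lam i))
    * mzv_reg T (shift_index lam).

(* C_{j+1,m}^T(k), with j counted from 0. *)
Definition tangent_coef (T : R[i]) (k : seq nat) (j m : nat) : R[i] :=
  \sum_(a < m.+1)
    (-1) ^+ (weight (take j k) + a)
    * mzv_reg_shift T a (rev (take j k))
    * mzv_reg_shift T (m - a) (drop j.+1 k).

End Regularized.

(* w is one of the indices (k_1 + lam_1, ..., k_r + lam_r) in the sum defining
   mzv_reg_shift T m k. *)
Definition occurs_in_shift (m : nat) (k w : seq nat) : Prop :=
  exists2 lam : (size k).-tuple 'I_m.+1, is_composition lam
                                       & w = shift_index lam.

(* Main.v *)
Require Import Defs.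
From HB Require Import structures.
From mathcomp Require Import all_boot all_order all_algebra.
From mathcomp Require Import classical_sets fsbigop cardinality.
From mathcomp Require Import ring lra zify.

(** The identity is the partial fraction expansion of the summand, summed over
all increasing tuples.

For a fixed increasing tuple n the rational function prod_i (n_i + s)^(-k_i) of
s equals the sum over j and m < k_j of c_(j,m)(n) (n_j + s)^(m - k_j), where
c_(j,m)(n) is the coefficient of x^m in prod_(i <> j) (n_i - n_j + x)^(-k_i)
([partial_fractions]). This coefficient only depends on the distances from n_j
to the entries on its left and on its right. An increasing tuple of integers is
the same thing as its entry n_j, an arbitrary integer, together with these two
sequences of distances, which are arbitrary increasing sequences of positive
integers ([unfold_at_bij]). So when k_j - m >= 2 the sum over n is the product
of the sum over n_j, which is T(k_j - m; s), and of two sums over the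
distances, which are the shifted multiple zeta values; the product of the two
is the coefficient of the statement ([csum_interaction]).

The terms m = k_j - 1 cannot be summed one at a time, since the sum of
1/(n_j + s) over n_j does not converge absolutely. But the summand is O(s^(-2))
at infinity, so for each n the residues c_(j,k_j-1)(n) add up to 0, and
1/(n_j + s) may be replaced by 1/(n_j + s) - 1/(n_1 + s)
([prod_partial_fractions_regular]). The family so obtained is absolutely
summable ([csummable_interaction_gap]), and with the distances fixed its sum
over n_j telescopes to 0 ([csum_gap]).

All the convergence statements come from one weight. For each D there is a
nonincreasing function damp with damp(q)^D >= 1/q and with sum damp(q)/q finite
([inv_le_dampX], [psummable_wt]); it behaves like q^(-1/D). When the largest
entry z of a tuple of at most D integers has a factor 1/z to spare, that factor
is at most the product of the damp(q) over all the entries q, which turns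
prod 1/q into a product of summable terms ([inv_le_prod_damp]).

Finally, every index that occurs is admissible, because k_1 and k_r are at
least 2, and the regularized value of an admissible index is its zeta value for
every T ([mzv_reg_admissible]). This is the uniqueness of the regularizing
decomposition: deleting a final letter 1 is a derivation for the stuffle
product ([stuffle_deriv_stuffle]) which kills admissible words and sends the
power (1)^l to l times (1)^(l-1), so that iterating it isolates the components
of a decomposition one after the other, from the highest power down
([reg_decomp_unique]). *)

Set Implicit Arguments.
Unset Strict Implicit.
Unset Printing Implicit Defensive.

Import Order.TTheory GRing.Theory Num.Theory Normc.
Local Open Scope classical_set_scope.
Local Open Scope ring_scope.

(** * Partial fractions *)

Section BinomialSeries.
Variable F : numFieldType.

Lemma gbinom0 (x : F) : gbinom x 0 = 1.
Proof. by rewrite /gbinom big_ord0 fact0 divr1. Qed.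

Lemma gbinomS (x : F) n : gbinom x n.+1 = gbinom x n * (x - n%:R) / n.+1%:R.
Proof.
have n0 : n.+1%:R != 0 :> F by rewrite pnatr_eq0.
have f0 : n`!%:R != 0 :> F by rewrite pnatr_eq0 -lt0n fact_gt0.
rewrite /gbinom big_ord_recr /= factS natrM.
by field; rewrite f0 addrC natr1 n0.
Qed.

Lemma gbinom_pascal (x : F) n :
  gbinom (x - 1) n.+1 + gbinom (x - 1) n = gbinom x n.+1.
Proof.
have xE : gbinom x n.+1 = x / n.+1%:R * gbinom (x - 1) n.
  rewrite /gbinom big_ord_recl /= subr0 factS natrM invfM.
  rewrite (eq_bigr (fun i : 'I_n => x - 1 - i%:R)); last first.
    by move=> i _; rewrite /bump /= natrD opprD addrA.
  by rewrite mulrACA.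
rewrite xE gbinomS.
have n0 : n.+1%:R != 0 :> F by rewrite pnatr_eq0.
have -> : n%:R = n.+1%:R - 1 :> F by rewrite -natr1 addrK.
by field; rewrite addrC natr1 n0.
Qed.

Lemma gbinom_0l n : gbinom (0 : F) n = (n == 0%N)%:R.
Proof.
case: n => [|n]; first by rewrite gbinom0.
by rewrite /gbinom big_ord_recl /= subrr !mul0r.
Qed.

(** The coefficient of x^l in (d + x)^(-k). *)
Definition invpow_coef (k : nat) (d : F) (l : nat) : F :=
  gbinom (- k%:R) l * d ^- (k + l).

(** The truncation at x^M of the power series (d + x)^(-k). *)
Definition invpow_poly (M k : nat) (d : F) : {poly F} :=
  \poly_(l < M) invpow_coef k d l.

(** This is (d + x) (d + x)^(-k-1) = (d + x)^(-k), read on coefficients. *)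
Lemma invpow_coef_shift k (d : F) l : d != 0 ->
  d * invpow_coef k.+1 d l + (if l is l'.+1 then invpow_coef k.+1 d l' else 0)
  = invpow_coef k d l.
Proof.
move=> d0; rewrite /invpow_coef; case: l => [|l].
  by rewrite addr0 !gbinom0 !mul1r !addn0 exprS invfM mulrA divff ?mul1r.
have -> : d ^- (k.+1 + l.+1) = d^-1 * d ^- (k.+1 + l).
  by rewrite addnS exprS invfM.
rewrite mulrCA mulVKf // -mulrDl.
rewrite -[k.+1]addn1 natrD opprD gbinom_pascal.
by rewrite -addnA add1n.
Qed.

Lemma invpow_poly0 M (d : F) i : (i < M)%N ->
  (invpow_poly M 0 d)`_i = (1 : {poly F})`_i.
Proof.
move=> iM; rewrite coef_poly iM /invpow_coef oppr0 gbinom_0l coef1 add0n.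
by case: i {iM} => [|i]; rewrite ?expr0 ?invr1 ?mul1r ?mul0r.
Qed.

End BinomialSeries.

Section PartialFractions.
Variables (F : numFieldType) (I : finType) (y : I -> F).
Hypothesis y_inj : injective y.

(** Congruence modulo X^M; it lets truncated power series be multiplied and
shifted without tracking the error terms. *)
Definition eqX M (p q : {poly F}) := forall i, (i < M)%N -> p`_i = q`_i.

Lemma eqX_mul M p q p' q' : eqX M p p' -> eqX M q q' -> eqX M (p * q) (p' * q').
Proof.
move=> pp qq i iM; rewrite !coefM; apply: eq_bigr => j _.
rewrite pp ?qq //; first by apply: leq_ltn_trans iM; exact: leq_subr.
by apply: leq_ltn_trans iM; rewrite -ltnS.
Qed.

Lemma eqX_prod M (J : Type) (s : seq J) (P : pred J) (p q : J -> {poly F}) :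
  (forall j, P j -> eqX M (p j) (q j)) ->
  eqX M (\prod_(j <- s | P j) p j) (\prod_(j <- s | P j) q j).
Proof.
move=> pq; elim/big_ind2 : _ => // *; exact: eqX_mul.
Qed.

Lemma invpow_poly_shift M k (d : F) : d != 0 ->
  eqX M ((d%:P + 'X) * invpow_poly M k.+1 d) (invpow_poly M k d).
Proof.
move=> d0 i iM.
rewrite mulrDl coefD coefCM coefXM !coef_poly iM -(invpow_coef_shift k i d0).
by case: i iM => //= i iM; rewrite (ltnW iM).
Qed.

Definition decr (k : {ffun I -> nat}) b : {ffun I -> nat} :=
  [ffun i => (k i - (i == b))%N].

Definition single j e : {ffun I -> nat} := [ffun i => if i == j then e else 0%N].

Variables (M : nat) (H : {ffun I -> nat} -> F).

(** The coefficient of (y_j + s)^(m - k_j) in prod_i (y_i + s)^(-k_i): substitute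
s = x - y_j and expand the factors i <> j around x = 0. *)
Definition local_coef (k : {ffun I -> nat}) j m : F :=
  (\prod_(i | i != j) invpow_poly M (k i) (y i - y j))`_m.

(** With H in place of prod_i y_i^(-k_i), this is the contribution of the j-th
pole; the value of H at [single j e] plays the role of y_j^(-e). *)
Definition principal_part (k : {ffun I -> nat}) j : F :=
  \sum_(m < k j) H (single j (k j - m)) * local_coef k j m.

(** Lowering the exponent k_b multiplies the series around y_j by
(y_b - y_j) + x. *)
Lemma local_coef_decr (k : {ffun I -> nat}) b j m : b != j -> (0 < k b)%N -> (m < M)%N ->
  local_coef (decr k b) j m = (y b - y j) * local_coef k j m
     + (if m is m'.+1 then local_coef k j m' else 0).
Proof.
move=> bj kb mM; rewrite /local_coef (bigD1 b) //=.
rewrite ffunE eqxx subn1.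
rewrite [X in _ * X](eq_bigr (fun i => invpow_poly M (k i) (y i - y j))); last first.
  by move=> i /andP[_ /negPf ib]; rewrite ffunE ib subn0.
set P := \prod_(i | _) _; pose A := invpow_poly M (k b) (y b - y j).
have d0 : y b - y j != 0 by rewrite subr_eq0; apply: contra bj => /eqP/y_inj ->.
have := @invpow_poly_shift M (k b).-1 _ d0; rewrite prednK // -/A => /(_ _ _) E.
transitivity ((((y b - y j)%:P + 'X) * A * P)`_m).
  by symmetry; apply: (@eqX_mul M).
rewrite -mulrA mulrDl coefD coefCM coefXM.
have AP : \prod_(i | i != j) invpow_poly M (k i) (y i - y j) = A * P.
  by rewrite (bigD1 b).
by rewrite AP; case: m mM.
Qed.

Lemma local_coef_decr_self (k : {ffun I -> nat}) j m : local_coef (decr k j) j m = local_coef k j m.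
Proof.
rewrite /local_coef; congr (polyseq _)`_m; apply: eq_bigr => i /negPf ij.
by rewrite ffunE ij subn0.
Qed.

(** At the pole a itself, lowering k_b adds x times the series; the shift of
indices it causes is undone by lowering k_a, which leaves the series around y_a
unchanged. *)
Lemma principal_part_decr_pole (k : {ffun I -> nat}) a b : a != b -> (0 < k a)%N -> (0 < k b)%N ->
  (k a <= M)%N ->
  (y b - y a) * principal_part k a
    = principal_part (decr k b) a - principal_part (decr k a) a.
Proof.
move=> ab ka kb kM; rewrite /principal_part !ffunE eqxx (negPf ab) subn0.
rewrite subn1; case E : (k a) ka => [//|n] ka /=.
rewrite [in X in _ = X - _](eq_bigr (fun m : 'I_n.+1 => (y b - y a) *
  (H (single a (n.+1 - m)) * local_coef k a m) + H (single a (n.+1 - m)) *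
  (if val m is m'.+1 then local_coef k a m' else 0))); last first.
  move=> m _; rewrite local_coef_decr // 1?eq_sym //; last first.
    by apply: leq_trans kM; rewrite E.
  by rewrite mulrDr mulrCA.
rewrite big_split /= -mulr_sumr -[LHS]addr0 -addrA; congr (_ + _); symmetry.
rewrite big_ord_recl /= mulr0 add0r.
rewrite -sumrB big1 // => m _; rewrite local_coef_decr_self /bump /= add1n subSS.
by rewrite subrr.
Qed.

Lemma principal_part_decr_other (k : {ffun I -> nat}) a b j : j != a -> j != b -> (0 < k a)%N ->
  (0 < k b)%N -> (k j <= M)%N ->
  (y b - y a) * principal_part k j
    = principal_part (decr k b) j - principal_part (decr k a) j.
Proof.
move=> ja jb ka kb kM; rewrite /principal_part !ffunE (negPf ja) (negPf jb) !subn0.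
rewrite -sumrB mulr_sumr; apply: eq_bigr => m _.
have mM : (m < M)%N by apply: leq_trans kM.
rewrite !local_coef_decr // 1?eq_sym // -mulrBr mulrCA; congr (_ * _).
by ring.
Qed.

Hypothesis H_rec : forall (k : {ffun I -> nat}) a b, a != b -> (0 < k a)%N -> (0 < k b)%N ->
  (y b - y a) * H k = H (decr k b) - H (decr k a).

Lemma sum_decr (k : {ffun I -> nat}) b : (0 < k b)%N ->
  (\sum_i k i = (\sum_i decr k b i).+1)%N.
Proof.
move=> kb; rewrite (bigD1 b) //= [in RHS](bigD1 b) //= ffunE eqxx -addSn.
rewrite subn1 prednK //; congr (_ + _)%N; apply: eq_bigr => i /negPf ib.
by rewrite ffunE ib subn0.
Qed.

(** The recursion H(k) (y_b - y_a) = H(k - e_b) - H(k - e_a), which for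
H(k) = prod_i y_i^(-k_i) is the identity y_b - y_a, determines H from its values
on multiples of unit vectors, and the sum of the principal parts satisfies the
same recursion. Leaving H free gives both the partial fraction expansion and
the vanishing of the sum of the residues. *)
Theorem partial_fractions (k : {ffun I -> nat}) :
  (0 < \sum_i k i)%N -> (forall i, (k i <= M)%N) ->
  H k = \sum_j principal_part k j.
Proof.
have [n] := ubnP (\sum_i k i)%N; elim: n k => // n IH k kn k0 kM.
have [a ka] : exists a, (0 < k a)%N.
  apply/existsP; apply: contraTT k0 => /existsPn h.
  by rewrite big1 // => i _; have := h i; lia.
have [/existsP[b /andP[ba kb]]|/existsPn one] := boolP [exists b, (b != a) && (0 < k b)%N].
  have dM c i : (decr k c i <= M)%N.
    by rewrite ffunE; apply: leq_trans (kM i); exact: leq_subr.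
  have ab : a != b by rewrite eq_sym.
  have Eb := sum_decr kb; have Ea := sum_decr ka.
  have yab : y b - y a != 0 by rewrite subr_eq0; apply: contra ba => /eqP/y_inj ->.
  apply: (mulfI yab); rewrite H_rec //.
  rewrite !IH //; last 4 first.
  - by rewrite Ea in kn.
  - by rewrite (bigD1 b) //= ffunE (negPf ba) subn0 ltn_addr.
  - by rewrite Eb in kn.
  - by rewrite (bigD1 a) //= ffunE (negPf ab) subn0 ltn_addr.
  rewrite mulr_sumr -sumrB; apply: eq_bigr => j _; symmetry.
  have [->|ja] := eqVneq j a; first exact: principal_part_decr_pole.
  have [->|jb] := eqVneq j b; last exact: principal_part_decr_other.
  by rewrite -[LHS]opprK -mulNr opprB principal_part_decr_pole // opprB.
have kE : k = single a (k a).
  apply/ffunP => i; rewrite ffunE; case: eqP => [->//|/eqP ia].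
  by have := one i; rewrite ia /=; lia.
rewrite (bigD1 a) //= [X in _ + X]big1 ?addr0; last first.
  move=> j ja; rewrite /principal_part.
  by have -> : k j = 0%N; [rewrite kE ffunE (negPf ja)|rewrite big_ord0].
have cE m : (m < M)%N -> local_coef k a m = (m == 0)%:R.
  move=> mM; rewrite /local_coef -coef1.
  suff E1 : eqX M (\prod_(i | i != a) invpow_poly M (k i) (y i - y a))
                 (\prod_(i | i != a) 1) by rewrite E1 // big1_eq.
  apply: eqX_prod => i ia l lM.
  by have -> : k i = 0%N; [rewrite kE ffunE (negPf ia)|rewrite invpow_poly0].
rewrite /principal_part; case E : (k a) => [|e]; first by rewrite E in ka.
rewrite big_ord_recl /= big1 ?addr0; last first.
  move=> m _; rewrite cE ?mulr0 //; apply: leq_trans (kM a); rewrite E.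
  by rewrite /bump /= add1n ltnS.
rewrite cE ?mulr1 ?subn0 -?E -?kE //; exact: leq_trans (kM a).
Qed.

End PartialFractions.

(** * Sums of nonnegative families *)

Section NonnegativeSums.
Context {R : realType}.
Implicit Types I J : choiceType.

Definition psummable I (D : set I) (f : I -> R) : Prop :=
  (\esum_(i in D) (f i)%:E < +oo)%E.

Definition psum I (D : set I) (f : I -> R) : R := fine (\esum_(i in D) (f i)%:E).

Definition nonneg_on I (D : set I) (f : I -> R) := forall i, D i -> 0 <= f i.

Lemma psummable_le I (D : set I) (f g : I -> R) :
  (forall i, D i -> f i <= g i) -> psummable D g -> psummable D f.
Proof.
move=> fg; apply: le_lt_trans; apply: le_esum => i Di; rewrite lee_fin; exact: fg.
Qed.

Lemma psumE I (D : set I) (f : I -> R) : nonneg_on D f -> psummable D f ->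
  (\esum_(i in D) (f i)%:E)%E = (psum D f)%:E.
Proof.
move=> f0 fs; rewrite /psum fineK // ge0_fin_numE //.
by apply: esum_ge0 => i Di; rewrite lee_fin f0.
Qed.

Lemma psum_ge0 I (D : set I) (f : I -> R) : nonneg_on D f -> 0 <= psum D f.
Proof. by move=> f0; apply/fine_ge0/esum_ge0 => i Di; rewrite lee_fin f0. Qed.

Lemma esumD_fin I (D : set I) (f g : I -> R) :
  nonneg_on D f -> nonneg_on D g ->
  (\esum_(i in D) (f i + g i)%:E
     = \esum_(i in D) (f i)%:E + \esum_(i in D) (g i)%:E)%E.
Proof.
move=> f0 g0; rewrite -esumD; first by apply: eq_esum.
- by move=> i Di; rewrite lee_fin f0.
- by move=> i Di; rewrite lee_fin g0.
Qed.

Lemma psummableD I (D : set I) (f g : I -> R) :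
  nonneg_on D f -> nonneg_on D g ->
  psummable D f -> psummable D g -> psummable D (fun i => f i + g i).
Proof. by move=> *; rewrite /psummable esumD_fin //; exact: lte_add_pinfty. Qed.

Lemma psumD I (D : set I) (f g : I -> R) :
  nonneg_on D f -> nonneg_on D g -> psummable D f -> psummable D g ->
  psum D (fun i => f i + g i) = psum D f + psum D g.
Proof.
move=> f0 g0 fs gs; rewrite {1}/psum esumD_fin // !psumE //.
Qed.

Lemma esumZ_fin I (D : set I) (c : R) (f : I -> R) : 0 <= c ->
  (\esum_(i in D) (c * f i)%:E = c%:E * \esum_(i in D) (f i)%:E)%E.
Proof.
rewrite le_eqVlt => /predU1P[<-|c0].
  by rewrite mul0e esum1 // => i _; rewrite mul0r.
have le (d : R) (g : I -> R) : 0 < d ->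
    (\esum_(i in D) (d * g i)%:E <= d%:E * \esum_(i in D) (g i)%:E)%E.
  move=> d0; apply: ge_ereal_sup => _ [X [Xfin XD] <-].
  rewrite fsumEFin // -mulr_fsumr EFinM lee_pmul2l // -fsumEFin //.
  by apply: ereal_sup_ubound; exists X.
apply/eqP; rewrite eq_le le //=.
have c1 : 0 < c^-1 by rewrite invr_gt0.
have := le _ (fun i => c * f i) c1.
rewrite (eq_esum (b := fun i => (f i)%:E)); last first.
  by move=> i _; rewrite mulKf // gt_eqF.
by move=> h; rewrite -(lee_pmul2l (x := c^-1%:E)) // muleA -EFinM mulVf ?gt_eqF // mul1e.
Qed.

Lemma psummableZ I (D : set I) (c : R) (f : I -> R) : 0 <= c ->
  nonneg_on D f -> psummable D f -> psummable D (fun i => c * f i).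
Proof. by move=> c0 f0 fs; rewrite /psummable esumZ_fin // psumE // -EFinM ltry. Qed.

Lemma psumZ I (D : set I) (c : R) (f : I -> R) : 0 <= c ->
  nonneg_on D f -> psummable D f -> psum D (fun i => c * f i) = c * psum D f.
Proof. by move=> c0 f0 fs; rewrite {1}/psum esumZ_fin // psumE. Qed.

Lemma esum_prod I J (D : set I) (E : set J) (f : I * J -> \bar R) :
  (forall i j, D i -> E j -> 0 <= f (i, j))%E ->
  (\esum_(p in D `*` E) f p = \esum_(i in D) \esum_(j in E) f (i, j))%E.
Proof.
move=> f0; rewrite (esum_esum (J := fun=> E)) //.
by apply: eq_esum => -[].
Qed.

Section Iterated.
Variables (I J : choiceType) (D : set I) (E : set J) (f : I * J -> R).
Hypothesis f0 : nonneg_on (D `*` E) f.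

Lemma psummable_slice : psummable (D `*` E) f ->
  forall i, D i -> psummable E (fun j => f (i, j)).
Proof.
rewrite /psummable esum_prod => [fs i Di|i j Di Ej]; last by rewrite lee_fin f0.
have e0 i' : D i' -> (0 <= \esum_(j in E) (f (i', j))%:E)%E.
  by move=> Di'; apply: esum_ge0 => j Ej; rewrite lee_fin f0.
have := @summable_pinfty _ _ D (fun i => \esum_(j in E) (f (i, j))%:E)%E _ i Di.
rewrite gee0_abs ?e0 //; apply.
by rewrite /summable (eq_esum (b := fun i => \esum_(j in E) (f (i, j))%:E)%E) // => x Dx; rewrite gee0_abs ?e0.
Qed.

Lemma slice_ge0 i : D i -> nonneg_on E (fun j => f (i, j)).
Proof. by move=> Di j Ej; exact: f0. Qed.

Lemma esum_slice : psummable (D `*` E) f ->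
  (\esum_(p in D `*` E) (f p)%:E
    = \esum_(i in D) (psum E (fun j => f (i, j)))%:E)%E.
Proof.
move=> fs; rewrite esum_prod => [|i j Di Ej]; last by rewrite lee_fin f0.
by apply: eq_esum => i Di; rewrite psumE //; [exact: slice_ge0|exact: psummable_slice].
Qed.

Lemma psummable_iter : psummable (D `*` E) f ->
  psummable D (fun i => psum E (fun j => f (i, j))).
Proof. by move=> fs; rewrite /psummable -esum_slice. Qed.

Lemma psum_iter : psummable (D `*` E) f ->
  psum (D `*` E) f = psum D (fun i => psum E (fun j => f (i, j))).
Proof. by move=> fs; rewrite {1}/psum esum_slice. Qed.

Lemma psummable_prod_bound (g : I -> R) :
  nonneg_on D g -> psummable D g ->
  (forall i, D i -> (\esum_(j in E) (f (i, j))%:E <= (g i)%:E)%E) ->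
  psummable (D `*` E) f.
Proof.
move=> g0 gs fg; rewrite /psummable esum_prod => [|i j Di Ej]; last by rewrite lee_fin f0.
by apply: le_lt_trans gs; apply: le_esum => i Di; exact: fg.
Qed.

End Iterated.

Lemma psummableM I J (D : set I) (E : set J) (f : I -> R) (g : J -> R) :
  nonneg_on D f -> nonneg_on E g -> psummable D f -> psummable E g ->
  psummable (D `*` E) (fun p => f p.1 * g p.2).
Proof.
move=> f0 g0 fs gs.
apply: (@psummable_prod_bound _ _ _ _ _ _ (fun i => psum E g * f i)).
- by move=> [i j] [Di Ej] /=; rewrite mulr_ge0 ?f0 ?g0.
- by move=> i Di; rewrite mulr_ge0 ?f0 ?psum_ge0.
- by apply: psummableZ => //; exact: psum_ge0.
- by move=> i Di; rewrite /= esumZ_fin ?f0 // psumE // -EFinM mulrC.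
Qed.

Lemma psummable_reindex I J (D : set I) (E : set J) (e : I -> J) (f : J -> R) :
  set_bij D E e -> psummable E f <-> psummable D (f \o e).
Proof. by move=> eb; rewrite /psummable (reindex_esum _ _ _ _ eb). Qed.

Lemma psummable_inj I J (D : set I) (E : set J) (e : I -> J) (f : J -> R) :
  set_fun D E e -> set_inj D e -> nonneg_on E f ->
  psummable E f -> psummable D (f \o e).
Proof.
move=> eDE ei f0 fs; rewrite /psummable -(esum_image D e (fun j => (f j)%:E)) //.
apply: le_lt_trans fs; rewrite esum_mkcond [leRHS]esum_mkcond.
apply: le_esum => j _; case: ifPn => [|_].
  by move=> /set_mem[i Di <-]; rewrite mem_set //; exact: eDE.
by case: ifPn => [/set_mem Ej|_]; rewrite ?lexx // lee_fin f0.
Qed.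

End NonnegativeSums.

(** * Absolutely convergent sums *)

Section AbsoluteSums.
Context {R : realType}.
Implicit Types I J : choiceType.

Definition rsummable I (D : set I) (f : I -> R) := psummable D (fun i => `|f i|).

(** A sum defined through positive and negative parts may be computed from any
other decomposition into a difference of nonnegative summable families. All
the rules for signed sums below reduce to nonnegative ones in this way. *)
Lemma rsum_diff I (D : set I) (f g h : I -> R) :
  nonneg_on D g -> nonneg_on D h -> psummable D g -> psummable D h ->
  (forall i, D i -> f i = g i - h i) -> rsum D f = psum D g - psum D h.
Proof.
move=> g0 h0 gs hs fE; rewrite /rsum.
have abs_summable (k : I -> R) : nonneg_on D k -> psummable D k ->
    summable D (EFin \o k).
  move=> k0 ks; rewrite /summable (eq_esum (b := fun i => (k i)%:E)) //.
  by move=> i Di /=; rewrite ger0_norm ?k0.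
rewrite (eq_esum (b := ((EFin \o g) \- (EFin \o h))%E^\+)%E); last first.
  by move=> i Di; rewrite !funeposE /= fE.
rewrite [X in fine (_ - X)](eq_esum (b := ((EFin \o g) \- (EFin \o h))%E^\-)%E); last first.
  by move=> i Di; rewrite !funenegE /= fE.
rewrite esumB ?(psumE g0) ?(psumE h0) //; try exact: abs_summable.
Qed.

Section Split.
Variables (I : choiceType) (D : set I) (f : I -> R).
Hypothesis fs : rsummable D f.
Let g i := `|f i| + f i.
Let h i := `|f i|.

Lemma split_ge0 : nonneg_on D g /\ nonneg_on D h.
Proof.
by split=> i _; rewrite /g /h // -lerBlDr sub0r -normrN ler_norm.
Qed.

Lemma split_psummable : psummable D g.
Proof.
have hs : psummable D (fun i => h i + h i).
  by apply: psummableD; rewrite // => i _; exact: normr_ge0.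
by apply: psummable_le hs => i _; rewrite lerD2l ler_norm.
Qed.

(** The decomposition f = (|f| + f) - |f| is convenient because both terms are
built from f by operations that commute with slicing. *)
Lemma rsum_split : rsum D f = psum D g - psum D h.
Proof.
have [g0 h0] := split_ge0.
by apply: rsum_diff => // [|i _]; [exact: split_psummable|rewrite /g /h addrAC subrr add0r].
Qed.
End Split.

Lemma rsum_ge0E I (D : set I) (f : I -> R) : nonneg_on D f -> psummable D f ->
  rsum D f = psum D f.
Proof.
move=> f0 fs; rewrite (rsum_diff (h := fun=> 0) f0) //.
- by rewrite {2}/psum esum1 ?subr0.
- by rewrite /psummable esum1.
- by move=> i _; rewrite subr0.
Qed.

Lemma rsumD I (D : set I) (f1 f2 : I -> R) : rsummable D f1 -> rsummable D f2 ->
  rsum D (fun i => f1 i + f2 i) = rsum D f1 + rsum D f2.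
Proof.
move=> s1 s2; have [g1 h1] := split_ge0 D f1; have [g2 h2] := split_ge0 D f2.
have p1 := split_psummable s1; have p2 := split_psummable s2.
rewrite (rsum_split s1) (rsum_split s2).
rewrite (rsum_diff (g := fun i => (`|f1 i| + f1 i) + (`|f2 i| + f2 i))
                   (h := fun i => `|f1 i| + `|f2 i|)).
- by rewrite (psumD g1 g2 p1 p2) (psumD h1 h2 s1 s2) opprD addrACA.
- by move=> i Di; rewrite addr_ge0 ?g1 ?g2.
- by move=> i Di; rewrite addr_ge0.
- exact: psummableD.
- exact: psummableD.
- by move=> i _; ring.
Qed.

Lemma rsumN I (D : set I) (f : I -> R) : rsummable D f ->
  rsum D (fun i => - f i) = - rsum D f.
Proof.
move=> s; have [g h] := split_ge0 D f; have p := split_psummable s.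
rewrite (rsum_split s) opprB.
by apply: rsum_diff => // i _; rewrite opprD addrA subrr sub0r.
Qed.

Lemma rsumZ I (D : set I) (c : R) (f : I -> R) : rsummable D f ->
  rsum D (fun i => c * f i) = c * rsum D f.
Proof.
have pos (d : R) (k : I -> R) : 0 <= d -> rsummable D k ->
    rsum D (fun i => d * k i) = d * rsum D k.
  move=> d0 s; have [g h] := split_ge0 D k; have p := split_psummable s.
  rewrite (rsum_split s) mulrBr -!psumZ //.
  apply: rsum_diff; try exact: psummableZ; try by move=> i Di; rewrite mulr_ge0 ?g ?h.
  by move=> i _; ring.
move=> s; have [c0|/ltW c0] := leP 0 c; first exact: pos.
have s' : rsummable D (fun i => - f i).
  by apply: psummable_le s => i _; rewrite normrN.
rewrite -[RHS]mulrNN -rsumN // -pos ?oppr_ge0 //.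
by congr rsum; apply/funext => i; rewrite mulrNN.
Qed.

Lemma rsum_iter I J (D : set I) (E : set J) (f : I * J -> R) :
  rsummable (D `*` E) f ->
  rsum (D `*` E) f = rsum D (fun i => rsum E (fun j => f (i, j))).
Proof.
move=> s; have [g h] := split_ge0 (D `*` E) f; have p := split_psummable s.
rewrite (rsum_split s) (psum_iter g p) (psum_iter h s); symmetry; apply: rsum_diff.
- by move=> i Di; apply: psum_ge0 => j Ej; exact: g.
- by move=> i Di; apply: psum_ge0 => j Ej; exact: h.
- exact: (psummable_iter g p).
- exact: (psummable_iter h s).
move=> i Di; apply: rsum_split; exact: (psummable_slice h s).
Qed.

Lemma eq_rsum I (D : set I) (f g : I -> R) : (forall i, D i -> f i = g i) ->
  rsum D f = rsum D g.
Proof.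
move=> fg; rewrite /rsum (eq_esum (b := (EFin \o g)%E^\+)%E); last first.
  by move=> i Di; rewrite !funeposE /= fg.
rewrite [X in fine (_ - X)](eq_esum (b := (EFin \o g)%E^\-)%E) //.
by move=> i Di; rewrite !funenegE /= fg.
Qed.

Lemma rsum_reindex I J (D : set I) (E : set J) (e : I -> J) (f : J -> R) :
  set_bij D E e -> rsum E f = rsum D (f \o e).
Proof.
move=> eb; rewrite /rsum !(reindex_esum _ _ _ _ eb).
rewrite (eq_esum (b := (EFin \o (f \o e))%E^\+)%E); last first.
  by move=> i Di; rewrite !funeposE.
rewrite [X in fine (_ - X)](eq_esum (b := (EFin \o (f \o e))%E^\-)%E) //.
by move=> i Di; rewrite !funenegE.
Qed.

Notation normc := (@Normc.normc R).

Lemma normc_ge0 z : 0 <= normc z.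
Proof. by case: z => a b; exact: sqrtr_ge0. Qed.

Lemma Re_le_normc z : `|complex.Re z| <= normc z.
Proof.
by case: z => a b /=; rewrite -sqrtr_sqr ler_wsqrtr // lerDl sqr_ge0.
Qed.

Lemma Im_le_normc z : `|complex.Im z| <= normc z.
Proof.
by case: z => a b /=; rewrite -sqrtr_sqr ler_wsqrtr // lerDr sqr_ge0.
Qed.

Lemma normc_real (x : R) : normc x%:C%C = `|x|.
Proof. by rewrite /= expr0n addr0 sqrtr_sqr. Qed.

Lemma normcX z n : normc (z ^+ n) = normc z ^+ n.
Proof. by elim: n => [|n IH]; rewrite ?expr0 ?normc1 // !exprS normcM IH. Qed.

Lemma normc_le_sum z : normc z <= `|complex.Re z| + `|complex.Im z|.
Proof.
have -> : z = (complex.Re z)%:C%C + (0 +i* complex.Im z)%C.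
  by case: z => a b; simpc.
apply: le_trans (le_normcD _ _) _; rewrite normc_real /=.
by rewrite expr0n /= add0r sqrtr_sqr addr0 add0r.
Qed.

Definition csummable I (D : set I) (f : I -> R[i]) :=
  psummable D (fun i => normc (f i)).

Lemma csummable_Re I (D : set I) (f : I -> R[i]) : csummable D f ->
  rsummable D (fun i => complex.Re (f i)).
Proof. by apply: psummable_le => i _; exact: Re_le_normc. Qed.

Lemma csummable_Im I (D : set I) (f : I -> R[i]) : csummable D f ->
  rsummable D (fun i => complex.Im (f i)).
Proof. by apply: psummable_le => i _; exact: Im_le_normc. Qed.

Lemma csummable_le I (D : set I) (f : I -> R[i]) (g : I -> R) :
  (forall i, D i -> normc (f i) <= g i) -> psummable D g -> csummable D f.
Proof. exact: psummable_le. Qed.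

Lemma eq_csum I (D : set I) (f g : I -> R[i]) :
  (forall i, D i -> f i = g i) -> csum D f = csum D g.
Proof. by move=> fg; congr Complex; apply: eq_rsum => i Di; rewrite fg. Qed.

Lemma eq_csummable I (D : set I) (f g : I -> R[i]) :
  (forall i, D i -> f i = g i) -> csummable D g -> csummable D f.
Proof. by move=> fg; apply: psummable_le => i Di; rewrite fg. Qed.

Lemma csum_reindex I J (D : set I) (E : set J) (e : I -> J) (f : J -> R[i]) :
  set_bij D E e -> csum E f = csum D (f \o e).
Proof. by move=> eb; congr Complex; exact: rsum_reindex. Qed.

Lemma csummable_reindex I J (D : set I) (E : set J) (e : I -> J) (f : J -> R[i]) :
  set_bij D E e -> csummable E f <-> csummable D (f \o e).
Proof. exact: psummable_reindex. Qed.

Lemma csummableD I (D : set I) (f g : I -> R[i]) :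
  csummable D f -> csummable D g -> csummable D (fun i => f i + g i).
Proof.
move=> fs gs; apply: (csummable_le (g := fun i => normc (f i) + normc (g i))).
  by move=> i _; exact: le_normcD.
by apply: psummableD => // i _; exact: normc_ge0.
Qed.

Lemma csummableZ I (D : set I) c (f : I -> R[i]) :
  csummable D f -> csummable D (fun i => c * f i).
Proof.
move=> fs; apply: (csummable_le (g := fun i => normc c * normc (f i))).
  by move=> i _; rewrite normcM.
by apply: psummableZ => // [|i _]; exact: normc_ge0.
Qed.

Lemma csummable0 I (D : set I) : csummable D (fun=> 0).
Proof. by rewrite /csummable /psummable esum1 // => i _; rewrite normc0. Qed.

Lemma csum0 I (D : set I) : csum D (fun=> 0) = 0 :> R[i].
Proof.
have r0 : rsum D (fun=> 0) = 0 :> R.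
  rewrite rsum_ge0E ?/psum ?esum1 // /psummable esum1 //.
by rewrite /csum r0.
Qed.

Lemma csumD I (D : set I) (f g : I -> R[i]) : csummable D f -> csummable D g ->
  csum D (fun i => f i + g i) = csum D f + csum D g.
Proof.
move=> fs gs; rewrite /csum [RHS]/(_ + _) /=; congr Complex; rewrite -rsumD.
- by apply: eq_rsum => i _; case: (f i) (g i) => [a b] [c d].
- exact: csummable_Re.
- exact: csummable_Re.
- by apply: eq_rsum => i _; case: (f i) (g i) => [a b] [c d].
- exact: csummable_Im.
- exact: csummable_Im.
Qed.

Lemma rsummableZ I (D : set I) c (f : I -> R) :
  rsummable D f -> rsummable D (fun i => c * f i).
Proof.
move=> fs; apply: (psummable_le (g := fun i => `|c| * `|f i|)).
  by move=> i _; rewrite normrM.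
exact: psummableZ.
Qed.

Lemma csumZ I (D : set I) c (f : I -> R[i]) : csummable D f ->
  csum D (fun i => c * f i) = c * csum D f.
Proof.
move=> fs; have rs := csummable_Re fs; have ims := csummable_Im fs.
case: c => a b; rewrite /csum [RHS]/(_ * _) /=; congr Complex.
  rewrite -!rsumZ // -rsumN; last exact: rsummableZ.
  rewrite -rsumD; first by apply: eq_rsum => i _; case: (f i).
    exact: rsummableZ.
  by rewrite /rsummable; under eq_fun do rewrite normrN; exact: rsummableZ.
rewrite -!rsumZ // -rsumD; first by apply: eq_rsum => i _; case: (f i).
  exact: rsummableZ.
exact: rsummableZ.
Qed.

Lemma csummable_sum I (D : set I) (K : Type) (s : seq K) (P : pred K)
    (F : K -> I -> R[i]) : (forall k, P k -> csummable D (F k)) ->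
  csummable D (fun i => \sum_(k <- s | P k) F k i).
Proof.
move=> Fs; elim: s => [|k s IH].
  by under eq_fun do rewrite big_nil; exact: csummable0.
under eq_fun do rewrite big_cons.
case: (boolP (P k)) => Pk //; by apply: csummableD => //; exact: Fs.
Qed.

Lemma csum_sum I (D : set I) (K : Type) (s : seq K) (P : pred K)
    (F : K -> I -> R[i]) : (forall k, P k -> csummable D (F k)) ->
  csum D (fun i => \sum_(k <- s | P k) F k i) = \sum_(k <- s | P k) csum D (F k).
Proof.
move=> Fs; elim: s => [|k s IH].
  by rewrite big_nil; under eq_fun do rewrite big_nil; exact: csum0.
rewrite big_cons -IH; under eq_fun do rewrite big_cons.
case: (boolP (P k)) => Pk //; apply: csumD; first exact: Fs.
exact: csummable_sum.
Qed.

Lemma csum_iter I J (D : set I) (E : set J) (f : I * J -> R[i]) :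
  csummable (D `*` E) f ->
  csum (D `*` E) f = csum D (fun i => csum E (fun j => f (i, j))).
Proof.
move=> s; congr Complex; apply: rsum_iter; first exact: csummable_Re.
exact: csummable_Im.
Qed.

Lemma csum_mul I J (D : set I) (E : set J) (f : I -> R[i]) (g : J -> R[i]) :
  csummable D f -> csummable E g ->
  csummable (D `*` E) (fun p => f p.1 * g p.2) /\
  csum (D `*` E) (fun p => f p.1 * g p.2) = csum D f * csum E g.
Proof.
move=> fs gs.
have s : csummable (D `*` E) (fun p => f p.1 * g p.2).
  rewrite /csummable; under eq_fun do rewrite normcM.
  by apply: (@psummableM _ _ _ _ _ (fun i => normc (f i)) (fun i => normc (g i)))
    => // i _; exact: normc_ge0.
split=> //; rewrite csum_iter //=; rewrite mulrC -csumZ //.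
by apply: eq_csum => i _; rewrite csumZ // mulrC.
Qed.

End AbsoluteSums.

(** * Uniqueness of the regularizing decomposition *)

(** Naming the basis vectors keeps their implicit structures identical from one
rewriting step to the next. *)
Definition word (w : seq nat) : index_span := << w >>.

(** The linear extension of a map defined on words. It is locked because
unfolding it during unification is very expensive. *)
HB.lock Definition linext (F : seq nat -> index_span) (x : index_span) : index_span := \sum_(u <- msupp x) x@_u *: F u.

Section LinearExtension.
Variable F : seq nat -> index_span.

Lemma linext_wider (d : {fset seq nat}) x : (msupp x `<=` d)%fset ->
  linext F x = \sum_(u <- d) x@_u *: F u.
Proof.
move=> xd; rewrite linext.unlock (big_fset_incl _ xd) // => u _ /mcoeff_outdom ->.
by rewrite scale0r.
Qed.

Fact linext_is_linear : linear (linext F).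
Proof.
move=> c x y; pose d := (msupp x `|` msupp y `|` msupp (c *: x + y))%fset.
rewrite !(@linext_wider d) /d ?fsubsetUr //; first last.
- by rewrite -fsetUA fsubsetUl.
- by rewrite fsetUAC fsubsetUr.
rewrite scaler_sumr -big_split /=; apply: eq_bigr => u _.
by rewrite mcoeffD mcoeffZ scalerDl scalerA.
Qed.

HB.instance Definition _ := GRing.isLinear.Build rat index_span index_span _ (linext F)
  linext_is_linear.

Lemma linextU u : linext F (word u) = F u.
Proof. by rewrite linext.unlock /word msuppU oner_eq0 big_seq_fset1 mcoeffUU scale1r. Qed.

End LinearExtension.

Lemma eq_linext F G x : (forall u, u \in msupp x -> F u = G u) -> linext F x = linext G x.
Proof.
by move=> FG; rewrite linext.unlock big_seq [RHS]big_seq; apply: eq_bigr => u /FG ->.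
Qed.

Lemma linext_id x : linext (fun u => word u) x = x.
Proof.
rewrite [RHS]monalgE linext.unlock; apply: eq_bigr => u _.
apply/malgP => v; rewrite mcoeffZ !mcoeffU.
by case: eqP; rewrite ?mulr1n ?mulr0n ?mulr1 ?mulr0.
Qed.

Lemma linext0 x : linext (fun=> 0) x = 0.
Proof. by rewrite linext.unlock big1 // => u _; rewrite scaler0. Qed.

Lemma linext_add F G x : linext (fun u => F u + G u) x = linext F x + linext G x.
Proof. by rewrite linext.unlock -big_split; apply: eq_bigr => u _; rewrite scalerDr. Qed.

Lemma linext_scale c F x : linext (fun u => c *: F u) x = c *: linext F x.
Proof.
rewrite linext.unlock scaler_sumr; apply: eq_bigr => u _.
by rewrite !scalerA mulrC.
Qed.

Lemma linear_linext (f : {linear index_span -> index_span}) F x :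
  f (linext F x) = linext (f \o F) x.
Proof. by rewrite linext.unlock linear_sum; apply: eq_bigr => u _; rewrite linearZ. Qed.

Lemma linext_exchange (F : seq nat -> seq nat -> index_span) x y :
  linext (fun u => linext (F u) y) x = linext (fun v => linext (F^~ v) x) y.
Proof.
rewrite linext.unlock; under eq_bigr do rewrite scaler_sumr.
rewrite exchange_big; apply: eq_bigr => v _; rewrite scaler_sumr.
by apply: eq_bigr => u _; rewrite !scalerA mulrC.
Qed.

Definition stuffle_word (u v : seq nat) : index_span := \sum_(w <- stuffle_words u v) word w.

Lemma stuffleE x y : stuffle x y = linext (fun u => linext (stuffle_word u) y) x.
Proof.
rewrite /stuffle linext.unlock; apply: eq_bigr => u _; rewrite scaler_sumr.
by apply: eq_bigr => v _; rewrite scalerA.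
Qed.

Definition prepend (a : nat) : index_span -> index_span := linext (fun w => word (a :: w)).
HB.instance Definition _ a := GRing.Linear.on (prepend a).

Lemma prependU a w : prepend a (word w) = word (a :: w). Proof. exact: linextU. Qed.

Lemma prepend_words a (s : seq (seq nat)) :
  prepend a (\sum_(w <- s) word w) = \sum_(w <- map (cons a) s) word w.
Proof. by rewrite linear_sum big_map; apply: eq_bigr => w _ /=; rewrite prependU. Qed.

Lemma stuffle_word0l v : stuffle_word [::] v = word v.
Proof. by rewrite /stuffle_word /= big_seq1. Qed.

Lemma stuffle_word0r u : stuffle_word u [::] = word u.
Proof. by case: u => [|a u]; rewrite /stuffle_word /= big_seq1. Qed.

Lemma stuffle_word_cons a u b v : stuffle_word (a :: u) (b :: v) =
  prepend a (stuffle_word u (b :: v)) + prepend b (stuffle_word (a :: u) v) + prepend (a + b) (stuffle_word u v).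
Proof. by rewrite /stuffle_word !prepend_words -!big_cat /= catA. Qed.

Definition drop_last_one (w : seq nat) : index_span :=
  if last 0%N w == 1%N then word (take (size w).-1 w) else 0.

Lemma drop_last_one_nil : drop_last_one [::] = 0. Proof. by []. Qed.

Lemma drop_last_one1 a : drop_last_one [:: a] = if a == 1%N then word [::] else 0.
Proof. by []. Qed.

Lemma drop_last_one_cons a w : w != [::] -> drop_last_one (a :: w) = prepend a (drop_last_one w).
Proof.
case: w => // b w _; rewrite /drop_last_one /=; case: ifP => _; last by rewrite linear0.
by rewrite prependU.
Qed.

Lemma last_admissible w : admissible w -> last 0%N w != 1%N.
Proof. by rewrite /admissible => /andP[_ /orP[/eqP ->//|]]; case: last => [|[]]. Qed.

Lemma drop_last_one_admissible w : admissible w -> drop_last_one w = 0.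
Proof. by move=> /last_admissible /negPf wl; rewrite /drop_last_one wl. Qed.

Definition stuffle_deriv := linext drop_last_one.
HB.instance Definition _ := GRing.Linear.on stuffle_deriv.

Lemma stuffle_derivU w : stuffle_deriv (word w) = drop_last_one w. Proof. exact: linextU. Qed.

Lemma stuffle_deriv_words (s : seq (seq nat)) :
  stuffle_deriv (\sum_(w <- s) word w) = \sum_(w <- s) drop_last_one w.
Proof. by rewrite linear_sum; apply: eq_bigr => w _ /=; rewrite stuffle_derivU. Qed.

Lemma stuffle_words_nonnil u v : (u != [::]) || (v != [::]) ->
  [::] \notin stuffle_words u v.
Proof.
case: u v => [|a u] [|b v] //= _; rewrite !mem_cat !negb_or.
by apply/and3P; split; apply/mapP => -[].
Qed.

Lemma stuffle_deriv_prepend a u v : (u != [::]) || (v != [::]) ->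
  stuffle_deriv (prepend a (stuffle_word u v)) = prepend a (stuffle_deriv (stuffle_word u v)).
Proof.
move=> /stuffle_words_nonnil nn; rewrite /stuffle_word prepend_words !stuffle_deriv_words.
rewrite linear_sum big_map big_seq [RHS]big_seq; apply: eq_bigr => w ws /=.
by rewrite drop_last_one_cons //; apply: contraNneq nn => <-.
Qed.

(** The recursion for the stuffle product survives [drop_last_one] on the left
factor. For a one-letter word the terms in [drop_last_one u] vanish, and the
empty word is absorbed into the term that starts with b. *)
Lemma stuffle_drop_last_one_l a u b v :
  linext (stuffle_word^~ (b :: v)) (drop_last_one (a :: u)) =
    prepend a (linext (stuffle_word^~ (b :: v)) (drop_last_one u))
    + prepend b (linext (stuffle_word^~ v) (drop_last_one (a :: u)))
    + prepend (a + b) (linext (stuffle_word^~ v) (drop_last_one u)).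
Proof.
have [->|u0] := eqVneq u [::].
  rewrite drop_last_one_nil drop_last_one1 !linear0 addr0 add0r; case: ifP => _.
    by rewrite !linextU !stuffle_word0l prependU.
  by rewrite !linear0.
rewrite !(drop_last_one_cons a u0) /drop_last_one; case: ifP => _; last by rewrite !linear0 !addr0.
by rewrite !prependU !linextU stuffle_word_cons.
Qed.

Lemma stuffle_drop_last_one_r a u b v :
  linext (stuffle_word (a :: u)) (drop_last_one (b :: v)) =
    prepend a (linext (stuffle_word u) (drop_last_one (b :: v)))
    + prepend b (linext (stuffle_word (a :: u)) (drop_last_one v))
    + prepend (a + b) (linext (stuffle_word u) (drop_last_one v)).
Proof.
have [->|v0] := eqVneq v [::].
  rewrite drop_last_one_nil drop_last_one1 !linear0 !addr0; case: ifP => _.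
    by rewrite !linextU !stuffle_word0r prependU.
  by rewrite !linear0.
rewrite !(drop_last_one_cons b v0) /drop_last_one; case: ifP => _; last by rewrite !linear0 !addr0.
by rewrite !prependU !linextU stuffle_word_cons.
Qed.

(** A final letter 1 of a stuffle of u and v is the final letter of u or of v: a
letter obtained by merging is at least 2, which is why the letters have to be
positive. *)
Lemma stuffle_deriv_words_product u v : is_index u -> is_index v ->
  stuffle_deriv (stuffle_word u v) = linext (stuffle_word^~ v) (drop_last_one u) + linext (stuffle_word u) (drop_last_one v).
Proof.
elim: u v => [|a u IHu] v.
  move=> _ _; rewrite stuffle_word0l stuffle_derivU drop_last_one_nil linear0 add0r.
  by rewrite (@eq_linext _ (fun u => word u)) ?linext_id // => w _; rewrite stuffle_word0l.
elim: v => [|b v IHv].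
  move=> _ _; rewrite stuffle_word0r stuffle_derivU drop_last_one_nil linear0 addr0.
  by rewrite (@eq_linext _ (fun u => word u)) ?linext_id // => w _; rewrite stuffle_word0r.
move=> /[dup] /andP[a0 iu] iau /[dup] /andP[b0 iv] ibv.
(* When u and v are both empty the merged word is the letter a + b, which is
   not 1, and both sides vanish. *)
have last_term : stuffle_deriv (prepend (a + b) (stuffle_word u v))
    = prepend (a + b) (stuffle_deriv (stuffle_word u v)).
  have [uv|] := boolP ((u != [::]) || (v != [::])); first exact: stuffle_deriv_prepend.
  rewrite negb_or !negbK => /andP[/eqP -> /eqP ->].
  rewrite stuffle_word0l prependU !stuffle_derivU drop_last_one_nil linear0 drop_last_one1.
  by case: eqP => //; lia.
rewrite stuffle_word_cons !linearD /= last_term !stuffle_deriv_prepend ?orbT //.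
rewrite IHu // IHv // IHu // stuffle_drop_last_one_l stuffle_drop_last_one_r !linearD /=.
by rewrite [RHS]addrACA; congr (_ + _); rewrite addrACA.
Qed.

Definition index_supp (x : index_span) := forall w, w \in msupp x -> is_index w.

Lemma stuffle_deriv_stuffle x y : index_supp x -> index_supp y ->
  stuffle_deriv (stuffle x y) = stuffle (stuffle_deriv x) y + stuffle x (stuffle_deriv y).
Proof.
move=> xi yi; rewrite !stuffleE linear_linext /stuffle_deriv linear_linext -linext_add.
apply: eq_linext => u ux /=; rewrite linext_exchange !linear_linext -linext_add.
by apply: eq_linext => v vy /=; rewrite stuffle_deriv_words_product; [|exact: xi|exact: yi].
Qed.

Lemma index_supp_sum (J : Type) (s : seq J) (P : pred J) (F : J -> index_span) :
  (forall j, P j -> index_supp (F j)) -> index_supp (\sum_(j <- s | P j) F j).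
Proof.
move=> Fi; elim/big_ind : _ => // [w|x y xi yi w]; first by rewrite msupp0.
by move=> /(fsubsetP (msuppD_le _ _)); rewrite in_fsetU => /orP[/xi|/yi].
Qed.

Lemma index_suppZ c x : index_supp x -> index_supp (c *: x).
Proof. by move=> xi w /(fsubsetP (msuppZ_le _ _)) /xi. Qed.

Lemma index_suppU w : is_index w -> index_supp (word w).
Proof. by move=> wi v; rewrite /word msuppU oner_eq0 in_fset1 => /eqP ->. Qed.

Lemma stuffle_words_index u v w : is_index u -> is_index v ->
  w \in stuffle_words u v -> is_index w.
Proof.
elim: u v w => [|a u IHu] v w; first by move=> _ vi; rewrite inE => /eqP ->.
elim: v w => [|b v IHv] w; first by move=> ui _; rewrite inE => /eqP ->.
move=> /[dup] /andP[a0 iu] iau /[dup] /andP[b0 iv] ibv.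
rewrite /= !mem_cat => /or3P[] /mapP[w' w's ->] /=; apply/andP; split => //.
- exact: IHu w's.
- exact: IHv w's.
- by rewrite ltn_addr.
- exact: IHu w's.
Qed.

Lemma index_supp_stuffle x y : index_supp x -> index_supp y ->
  index_supp (stuffle x y).
Proof.
move=> xi yi; rewrite /stuffle big_seq; apply: index_supp_sum => u ux.
rewrite big_seq; apply: index_supp_sum => v vy; apply: index_suppZ.
rewrite big_seq; apply: index_supp_sum => w ws; apply: index_suppU.
by apply: stuffle_words_index ws; [exact: xi|exact: yi].
Qed.

Definition one_pow l := stuffle_pow (word [:: 1%N]) l.

Lemma one_powS l : one_pow l.+1 = stuffle (word [:: 1%N]) (one_pow l).
Proof. by []. Qed.

Lemma index_supp_one_pow l : index_supp (one_pow l).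
Proof.
elim: l => [|l IH]; first exact: index_suppU.
by rewrite one_powS; apply: index_supp_stuffle => //; exact: index_suppU.
Qed.

Lemma stuffle0l x : stuffle 0 x = 0.
Proof. by rewrite stuffleE linear0. Qed.

Lemma stuffleZr c x y : stuffle x (c *: y) = c *: stuffle x y.
Proof.
rewrite !stuffleE -linext_scale; apply: eq_linext => u _; by rewrite linearZ.
Qed.

Lemma stuffle_nilr x : stuffle x (word [::]) = x.
Proof.
rewrite stuffleE (@eq_linext _ (fun u => word u)) ?linext_id // => u _.
by rewrite linextU stuffle_word0r.
Qed.

Lemma stuffle_nill x : stuffle (word [::]) x = x.
Proof.
rewrite stuffleE linextU (@eq_linext _ (fun u => word u)) ?linext_id // => u _.
by rewrite stuffle_word0l.
Qed.

Lemma stuffle_deriv_one_pow l : stuffle_deriv (one_pow l) = l%:R *: one_pow l.-1.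
Proof.
elim: l => [|l IH]; first by rewrite stuffle_derivU drop_last_one_nil scale0r.
rewrite one_powS stuffle_deriv_stuffle; last 2 first.
- exact: index_suppU.
- exact: index_supp_one_pow.
rewrite IH stuffle_derivU drop_last_one1 eqxx stuffle_nill stuffleZr /=.
case: l {IH} => [|l]; first by rewrite scale0r addr0 scale1r.
by rewrite -one_powS -[X in X + _]scale1r -scalerDl nat1r.
Qed.

Lemma iter_stuffle_deriv_one_pow n l :
  iter n stuffle_deriv (one_pow l) = (l ^_ n)%:R *: one_pow (l - n).
Proof.
elim: n => [|n IH]; first by rewrite ffactn0 scale1r subn0.
rewrite iterS IH linearZ /= stuffle_deriv_one_pow scalerA -natrM.
by rewrite -ffactnSr subnS.
Qed.

Lemma admissible_span_index x : admissible_span x -> index_supp x.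
Proof. by move=> xa w /xa /andP[]. Qed.

Lemma stuffle_deriv_admissible x : admissible_span x -> stuffle_deriv x = 0.
Proof.
move=> xa; rewrite /stuffle_deriv (@eq_linext _ (fun=> 0)) ?linext0 // => w /xa.
exact: drop_last_one_admissible.
Qed.

Lemma iter_stuffle_deriv_stuffle n x l : admissible_span x ->
  iter n stuffle_deriv (stuffle x (one_pow l)) = (l ^_ n)%:R *: stuffle x (one_pow (l - n)).
Proof.
move=> xa; rewrite -stuffleZr -iter_stuffle_deriv_one_pow.
elim: n => [//|n IH]; rewrite !iterS IH stuffle_deriv_stuffle; last 2 first.
- exact: admissible_span_index.
- rewrite iter_stuffle_deriv_one_pow; apply: index_suppZ; exact: index_supp_one_pow.
by rewrite stuffle_deriv_admissible // stuffle0l add0r.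
Qed.

Lemma iter_stuffle_deriv_sum n (J : Type) (s : seq J) (F : J -> index_span) :
  iter n stuffle_deriv (\sum_(j <- s) F j) = \sum_(j <- s) iter n stuffle_deriv (F j).
Proof. by elim: n => [//|n IH]; rewrite iterS IH linear_sum. Qed.

(** Applying the derivation n times to a decomposition of length n + 1 kills
everything except n! times the last component; on the other side it kills the
admissible element x. So the last component is 0, and the length drops. *)
Lemma reg_decomp_unique x (n : nat) (u : nat -> index_span) :
  admissible_span x -> (forall l, (l <= n)%N -> admissible_span (u l)) ->
  x = \sum_(l < n.+1) stuffle (u l) (one_pow l) ->
  u 0%N = x /\ forall l, (0 < l <= n)%N -> u l = 0.
Proof.
move=> xa; elim: n => [|n IH] ua xE.
  split; first by rewrite xE big_ord_recl big_ord0 addr0 stuffle_nilr.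
  by case=> [|l].
suff un : u n.+1 = 0.
  have [||u0 ul] := IH; first by move=> l ln; apply: ua; exact: leqW.
    by rewrite xE big_ord_recr /= un stuffle0l addr0.
  split=> // l /andP[l0]; rewrite leq_eqVlt => /predU1P[->//|ln].
  by apply: ul; rewrite l0.
have := congr1 (iter n.+1 stuffle_deriv) xE.
rewrite iterSr stuffle_deriv_admissible // iter_stuffle_deriv_sum.
have -> : iter n stuffle_deriv 0 = 0.
  by elim: n {IH ua xE} => //= n ->; rewrite linear0.
rewrite big_ord_recr big1 => [|l _]; last first.
  rewrite (iter_stuffle_deriv_stuffle n.+1); last by apply: ua; exact: ltnW (ltn_ord l).
  by rewrite /= ffact_small ?scale0r.
rewrite Monoid.mul1m (iter_stuffle_deriv_stuffle n.+1); last exact: ua.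
rewrite subnn stuffle_nilr => /esym/eqP.
rewrite scaler_eq0 => /orP[|/eqP //]; rewrite ffactnn pnatr_eq0.
by rewrite eqn0Ngt fact_gt0.
Qed.

Lemma reg_decomp_admissible k : admissible k ->
  reg_decomp k = [ffun l => if l == ord0 then word k else 0].
Proof.
move=> ka; have kspan : admissible_span (word k).
  by move=> w; rewrite /word msuppU oner_eq0 in_fset1 => /eqP ->.
pose u0 : {ffun 'I_(size k).+1 -> index_span} :=
  [ffun l => if l == ord0 then word k else 0].
have dec0 : is_reg_decomp u0.
  split=> [l w|].
    by rewrite ffunE; case: ifP => _; [exact: kspan|rewrite msupp0].
  rewrite big_ord_recl big1 ?addr0 => [|l _]; last by rewrite ffunE /= stuffle0l.
  by rewrite ffunE eqxx stuffle_nilr.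
(* The choice operator returns some decomposition; uniqueness identifies it
   with the obvious one. *)
have [ua ksum] : is_reg_decomp (reg_decomp k).
  by rewrite /reg_decomp; apply: (xgetPex _ (P := [set u | is_reg_decomp u])); exists u0.
have [||v0 vl] := @reg_decomp_unique (word k) (size k)
    (fun l => reg_decomp k (inord l)) kspan.
- by move=> l _; exact: ua.
- by rewrite [LHS]ksum; apply: eq_bigr => l _; rewrite inord_val.
apply/ffunP => l; rewrite ffunE; case: eqP => [->|/eqP l0].
  by rewrite -v0; congr (reg_decomp k _); apply/val_inj; rewrite /= inordK.
rewrite -[l in LHS]inord_val vl //; apply/andP; split; last by rewrite -ltnS ltn_ord.
by rewrite lt0n; apply: contra l0 => /eqP l0; apply/eqP/val_inj.
Qed.

Lemma mzv_reg_admissible (R : realType) (T : R[i]) k : admissible k ->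
  mzv_reg T k = (mzv k)%:C%C.
Proof.
move=> ka; rewrite /mzv_reg reg_decomp_admissible // big_ord_recl big1 => [|l _].
  rewrite addr0 expr0 mulr1 ffunE eqxx /mzv_span /word msuppU oner_eq0 big_seq_fset1.
  by rewrite /word mcoeffUU rmorph1 mul1r.
by rewrite ffunE /= /mzv_span msupp0 big_nil mul0r.
Qed.

(** * Sums over the integers *)

Section SumsOverIntegers.
Context {R : realType}.
Notation normc := (@Normc.normc R).

Definition window (M : nat) : set int := [set N : int | - M%:Z < N <= M%:Z].

Lemma window_bij M : set_bij `I_(M + M) (window M) (fun i : nat => i%:Z + 1 - M%:Z).
Proof.
split.
- by move=> i /=; rewrite /window /=; lia.
- by move=> i j _ _ /=; lia.
- move=> N /= NM; exists (absz (N + M%:Z - 1)%R); rewrite /window /= in NM *; lia.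
Qed.

Lemma fsum_window (g : int -> R) M :
  \sum_(N \in window M) g N = \sum_(i < M + M) g (i%:Z + 1 - M%:Z).
Proof.
rewrite (reindex_fsbig _ _ _ _ (window_bij M)).
by rewrite -(fsbig_ord _ _ (fun i : nat => g (i%:Z + 1 - M%:Z))).
Qed.

Lemma finite_window M : finite_set (window M).
Proof.
have -> : window M = [set i%:Z + 1 - M%:Z | i in `I_(M + M)].
  apply/seteqP; split=> [N|_ [i iM <-]].
    by move=> /(set_bij_surj (window_bij M)) [i iM <-]; exists i.
  by have [+ _ _] := window_bij M; apply.
exact/finite_image/finite_II.
Qed.

Lemma psum_window_le (g : int -> R) M : nonneg_on setT g -> psummable setT g ->
  \sum_(i < M + M) g (i%:Z + 1 - M%:Z) <= psum setT g.
Proof.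
move=> g0 gs; rewrite -fsum_window -lee_fin -psumE // -fsumEFin; last exact: finite_window.
by apply: ereal_sup_ubound; exists (window M) => //; split=> //; exact: finite_window.
Qed.

Lemma psum_window_ge (g : int -> R) (e : R) : nonneg_on setT g ->
  psummable setT g -> 0 < e ->
  exists M0 : nat, forall M, (M0 <= M)%N ->
    psum setT g - e <= \sum_(i < M + M) g (i%:Z + 1 - M%:Z).
Proof.
move=> g0 gs e0; have := psumE g0 gs; rewrite /esum => supE.
have : ((psum setT g - e)%:E < ereal_sup [set \sum_(x \in A) (g x)%:E | A in fsets setT])%E.
  by rewrite supE lte_fin ltrBlDr ltrDl.
move=> /ereal_sup_gt[_ [X [Xfin _] <-]]; rewrite fsumEFin // lte_fin => /ltW Xge.
exists (\max_(x <- fset_set X) (absz x).+1)%N => M M0.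
apply: le_trans Xge _; rewrite -fsum_window -lee_fin -!fsumEFin //; last first.
  exact: finite_window.
apply: lee_fsum_nneg_subset => //; first exact: finite_window.
  move=> x; rewrite !inE => Xx; rewrite /window /=.
  have : ((absz x).+1 <= M)%N.
    apply: leq_trans M0; apply: (@leq_bigmax_seq _ _ xpredT (fun x => (absz x).+1)) => //.
    by rewrite in_fset_set // inE.
  by lia.
by move=> t _; rewrite lee_fin; exact: g0.
Qed.

Lemma rsum_window (f : int -> R) (e : R) : rsummable setT f -> 0 < e ->
  exists M0 : nat, forall M, (M0 <= M)%N ->
    `|rsum setT f - \sum_(i < M + M) f (i%:Z + 1 - M%:Z)| <= e.
Proof.
move=> fs e0; have [g0 h0] := split_ge0 setT f; have gs := split_psummable fs.
have [M1 H1] := psum_window_ge g0 gs e0; have [M2 H2] := psum_window_ge h0 fs e0.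
exists (maxn M1 M2) => M; rewrite geq_max => /andP[/H1 {}H1 /H2 {}H2].
have := psum_window_le M g0 gs; have := psum_window_le M h0 fs.
rewrite (rsum_split fs).
have -> : \sum_(i < M + M) f (i%:Z + 1 - M%:Z) =
    \sum_(i < M + M) (`|f (i%:Z + 1 - M%:Z)| + f (i%:Z + 1 - M%:Z))
    - \sum_(i < M + M) `|f (i%:Z + 1 - M%:Z)|.
  by rewrite -sumrB; apply: eq_bigr => i _; rewrite [RHS]addrAC subrr add0r.
move: H1 H2.
set a := psum _ _; set b := psum _ _; set c := \sum_(i < _) _; set d := \sum_(i < _) _.
by move=> *; rewrite ler_norml; lra.
Qed.

Lemma Re_sum n (F : 'I_n -> R[i]) :
  complex.Re (\sum_i F i) = \sum_i complex.Re (F i).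
Proof. by elim/big_rec2 : _ => // i x y _ <-; case: (F i) y => [a b] [c d]. Qed.

Lemma Im_sum n (F : 'I_n -> R[i]) :
  complex.Im (\sum_i F i) = \sum_i complex.Im (F i).
Proof. by elim/big_rec2 : _ => // i x y _ <-; case: (F i) y => [a b] [c d]. Qed.

(** The sum over the window ]-M, M] is h(M) - h(-M), which tends to 0. *)
Lemma csum_telescope (h : int -> R[i]) :
  csummable setT (fun N => h N - h (N - 1)) ->
  (forall e : R, 0 < e -> exists M0 : nat, forall M : nat, (M0 <= M)%N ->
     normc (h M%:Z) <= e /\ normc (h (- M%:Z)) <= e) ->
  csum setT (fun N => h N - h (N - 1)) = 0.
Proof.
move=> hs h_lim; set f := fun N => _ in hs *; set S := csum _ _.
suff small (e : R) : 0 < e -> normc S <= e *+ 4.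
  apply: eq0_normc; apply/eqP; rewrite eq_le normc_ge0 andbT.
  apply/ler_addgt0Pl => e e0; rewrite addr0.
  have := small (e / 4); rewrite -[_ / _ *+ 4]mulr_natr divfK ?pnatr_eq0 //; apply.
  by rewrite divr_gt0.
move=> e0; have [M1 H1] := rsum_window (csummable_Re hs) e0.
have [M2 H2] := rsum_window (csummable_Im hs) e0; have [M3 H3] := h_lim _ e0.
pose M := maxn M1 (maxn M2 M3).
have /H1 {}H1 : (M1 <= M)%N by rewrite leq_maxl.
have /H2 {}H2 : (M2 <= M)%N by rewrite /M maxnCA leq_maxl.
have /H3 [h1 h2] : (M3 <= M)%N by rewrite /M maxnA leq_maxr.
(* The windows are indexed by i < 2M through N = i + 1 - M. *)
have tele : \sum_(i < M + M) f (i%:Z + 1 - M%:Z) = h M%:Z - h (- M%:Z).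
  rewrite -(big_mkord xpredT (fun i : nat => f (i%:Z + 1 - M%:Z))).
  rewrite (telescope_sumr_eq (fun i : nat => h (i%:Z - M%:Z))) //.
    by rewrite sub0r PoszD addrK.
  by move=> i _; rewrite /f; congr (h _ - h _); lia.
have -> : S = (S - (h M%:Z - h (- M%:Z))) + (h M%:Z - h (- M%:Z)) by rewrite subrK.
apply: le_trans (le_normcD _ _) _.
rewrite (_ : e *+ 4 = (e + e) + (e + e)); last by rewrite !mulrS mulr0n; ring.
apply: lerD; last first.
  by apply: le_trans (le_normcD _ _) _; rewrite normcN lerD.
apply: le_trans (normc_le_sum _) _; apply: lerD.
  move: H1; rewrite -Re_sum tele /S /csum.
  by case: (h _) (h _) => [a b] [c d] /=.
move: H2; rewrite -Im_sum tele /S /csum.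
by case: (h _) (h _) => [a b] [c d] /=.
Qed.

(** For large N this is the triangle inequality; the finitely many other values
are nonzero because s is not an integer. *)
Lemma normc_intD_ge (s : R[i]) : (forall n : int, s <> n%:~R) ->
  exists2 c : R, 0 < c & forall N : int, c * (absz N).+1%:R <= normc (N%:~R + s).
Proof.
move=> sZ.
have pos N : 0 < normc (N%:~R + s).
  rewrite lt_neqAle normc_ge0 andbT eq_sym; apply/eqP => /eq0_normc /eqP.
  by rewrite addrC addr_eq0 -rmorphN => /eqP /sZ.
have low (K : nat) : exists2 c : R, 0 < c &
    forall N : int, (absz N < K)%N -> c <= normc (N%:~R + s).
  elim: K => [|K [c c0 cN]]; first by exists 1.
  exists (Num.min c (Num.min (normc (K%:Z%:~R + s)) (normc ((- K%:Z)%:~R + s)))).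
    by rewrite !lt_min c0 !pos.
  move=> N; rewrite ltnS leq_eqVlt => /predU1P[NK|NK]; last first.
    by rewrite ge_min cN.
  have [->|->] : N = K%:Z \/ N = - K%:Z by lia.
    by rewrite !ge_min lexx orbT.
  by rewrite !ge_min lexx !orbT.
(* For |N| >= K > 2|s| + 1, |N + s| >= |N| - |s| >= (|N| + 1) / 2. *)
pose K := Num.bound (normc s *+ 2 + 1).
have KP : normc s *+ 2 + 1 < K%:R.
  by apply: archi_boundP; rewrite addr_ge0 // mulrn_wge0 // normc_ge0.
have [c c0 cN] := low K.
exists (Num.min (2^-1) (c / K.+1%:R)).
  by rewrite lt_min divr_gt0 // invr_gt0 ltr0n.
move=> N; have [NK|NK] := ltnP (absz N) K.
  apply: le_trans (cN N NK).
  apply: (@le_trans _ _ (c / K.+1%:R * (absz N).+1%:R)).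
    by rewrite ler_pM2r ?ltr0n // ge_min lexx orbT.
  rewrite -mulrA ler_piMr ?(ltW c0) // mulrC ler_pdivrMr ?ltr0n // mul1r.
  by rewrite ler_nat; lia.
apply: (@le_trans _ _ (2^-1 * (absz N).+1%:R)).
  by rewrite ler_pM2r ?ltr0n // ge_min lexx.
have N_le : (absz N)%:R <= normc (N%:~R + s) + normc s.
  have -> : (absz N)%:R = normc (N%:~R : R[i]).
    by rewrite -(rmorph_int (real_complex R)) normc_real natr_absz intr_norm.
  rewrite -[X in normc X <= _](addrK s) -(normcN s); exact: le_normcD.
have : K%:R <= (absz N)%:R :> R by rewrite ler_nat.
rewrite -[(absz N).+1%:R]natr1; move: KP N_le; move: (normc s) (normc _) => x y.
by rewrite mulr2n; lra.
Qed.

End SumsOverIntegers.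

(** * Summable weights *)

Section Weights.
Context {R : realType}.
Variable D : nat.
Hypothesis D0 : (0 < D)%N.

(** The product of the 1 - 1/i for 2 <= i <= q is 1/q; dividing each 1/i by D gives,
up to a constant, q^(-1/D), while sums and comparisons stay elementary. *)
Definition damp (q : nat) : R := \prod_(2 <= i < q.+1) (1 - (D * i)%:R^-1).
Definition wt (q : nat) : R := damp q / q%:R.

Let factor_bounds i : (1 < i)%N -> 0 < 1 - (D * i)%:R^-1 :> R /\ 1 - (D * i)%:R^-1 <= 1 :> R.
Proof.
move=> i1; have Di : (1 < D * i)%N by apply: leq_trans i1 _; rewrite leq_pmull.
split; last by rewrite lerBlDr lerDl invr_ge0.
by rewrite subr_gt0 invf_lt1 ?ltr1n // ltr0n ltnW.
Qed.

Lemma damp1 : damp 1 = 1. Proof. by rewrite /damp big_geq. Qed.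
Lemma damp0 : damp 0 = 1. Proof. by rewrite /damp big_geq. Qed.

Lemma dampS q : (0 < q)%N -> damp q.+1 = damp q * (1 - (D * q.+1)%:R^-1).
Proof. by move=> q0; rewrite /damp big_nat_recr. Qed.

Lemma damp_gt0 q : 0 < damp q.
Proof.
case: q => [|q]; first by rewrite damp0.
elim: q => [|q IH]; first by rewrite damp1.
by rewrite dampS // mulr_gt0 //; have [] := @factor_bounds q.+2 isT.
Qed.

Lemma damp_antitone p q : (p <= q)%N -> damp q <= damp p.
Proof.
move=> /subnK <-; elim: (q - p)%N => // n; apply: le_trans; rewrite addSn.
case E : (n + p)%N => [|m]; first by rewrite damp0 damp1.
by rewrite dampS // ler_piMr ?(ltW (damp_gt0 _)) //; have [] := @factor_bounds m.+2 isT.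
Qed.

Lemma damp_le1 q : damp q <= 1.
Proof. by rewrite -damp0 damp_antitone. Qed.

Lemma bernoulli_ineq (t : R) n : 0 <= t <= 1 -> 1 - n%:R * t <= (1 - t) ^+ n.
Proof.
move=> /andP[t0 t1]; elim: n => [|n IH]; first by rewrite mul0r subr0 expr0.
rewrite exprS; apply: (@le_trans _ _ ((1 - t) * (1 - n%:R * t))).
  have : 0 <= n%:R * (t * t) by rewrite mulr_ge0 // mulr_ge0.
  by rewrite -natr1; move: (n%:R : R) => x; nra.
by rewrite ler_wpM2l // subr_ge0.
Qed.

(** By the Bernoulli inequality each factor satisfies
(1 - 1/(D i))^D >= 1 - 1/i, and the product of the right hand sides telescopes
to 1/q. *)
Lemma inv_le_dampX q : (0 < q)%N -> q%:R^-1 <= damp q ^+ D.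
Proof.
case: q => // q _; elim: q => [|q IH]; first by rewrite damp1 expr1n invr1.
rewrite dampS // exprMn; have Dq : (0 < D * q.+2)%N by rewrite muln_gt0 D0.
have t01 : 0 <= ((D * q.+2)%:R^-1 : R) <= 1.
  by rewrite invr_ge0 ler0n /= invf_le1 ?ler1n // ltr0n.
apply: le_trans (ler_pM _ _ IH (@bernoulli_ineq _ D t01)).
- rewrite natrM invfM mulrA divff ?pnatr_eq0 -?lt0n // mul1r.
  have q1 : q.+1%:R != 0 :> R by rewrite pnatr_eq0.
  have q2 : q.+2%:R = q.+1%:R + 1 :> R by rewrite natr1.
  have q2n : q.+1%:R + 1 != 0 :> R by rewrite -q2 pnatr_eq0.
  rewrite q2; move: q1 q2n; move: (q.+1%:R : R) => x x0 x1.
  rewrite le_eqVlt; apply/orP; left; apply/eqP; field; by rewrite x0 x1.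
- by rewrite invr_ge0.
- rewrite natrM invfM mulrA divff ?pnatr_eq0 -?lt0n // mul1r subr_ge0.
  by rewrite invf_le1 ?ler1n // ltr0n.
Qed.

(** The factors damp(x) are at most D in number, at most 1, and at least damp(z), so
their product is at least damp(z)^D, hence at least 1/z. *)
Lemma inv_le_prod_damp z (s : seq nat) : (0 < z)%N -> all (geq z) s ->
  (size s <= D)%N -> z%:R^-1 <= \prod_(x <- s) damp x.
Proof.
move=> z0 sz sD; apply: (@le_trans _ _ (damp z ^+ size s)).
  apply: le_trans (inv_le_dampX z0) _.
  by apply: ler_wiXn2l => //; [exact/ltW/damp_gt0|exact: damp_le1].
elim: s sz {sD} => [|x s IH] /=; first by rewrite big_nil expr0.
move=> /andP[xz /IH {}IH]; rewrite big_cons exprS ler_pM //.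
- exact/ltW/damp_gt0.
- by rewrite exprn_ge0 // ltW // damp_gt0.
- exact: damp_antitone.
Qed.

Lemma wt_ge0 q : 0 <= wt q.
Proof. by rewrite divr_ge0 // ltW // damp_gt0. Qed.

(** The weight is a telescoping difference:
damp(q) - damp(q + 1) = damp(q) / (D (q + 1)). *)
Lemma sum_wt_le M : \sum_(i < M.+2) wt i <= 1 + D%:R * (1 - damp M.+1).
Proof.
elim: M => [|M IH].
  by rewrite !big_ord_recl big_ord0 /wt /= invr0 mulr0 add0r damp1 addr0 divr1 subrr mulr0 addr0.
rewrite big_ord_recr /=; apply: le_trans (lerD IH (lexx _)) _.
rewrite -addrA lerD2l -lerBrDl -mulrBr.
rewrite (_ : 1 - damp M.+2 - (1 - damp M.+1) = damp M.+1 - damp M.+2); last by ring.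
have -> : D%:R * (damp M.+1 - damp M.+2) = damp M.+1 / M.+2%:R.
  rewrite (@dampS M.+1) // natrM; have d0 : D%:R != 0 :> R by rewrite pnatr_eq0 -lt0n.
  have m0 : M.+2%:R != 0 :> R by rewrite pnatr_eq0.
  by move: m0; move: (M.+2%:R : R) => x x0; field; rewrite d0 x0.
by rewrite /wt ler_pM2r ?invr_gt0 ?ltr0n // damp_antitone.
Qed.

Lemma psummable_wt : psummable setT wt.
Proof.
apply: (@le_lt_trans _ _ (1 + D%:R)%:E); last exact: ltry.
apply: ge_ereal_sup => _ [X [Xfin _] <-].
pose M := (\max_(x <- fset_set X) x)%N.
have XM : X `<=` `I_M.+2.
  move=> x Xx /=; rewrite ltnS; apply/leqW.
  by apply: (@leq_bigmax_seq _ _ xpredT (fun x => x)); rewrite // in_fset_set // inE.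
apply: (@le_trans _ _ (\sum_(x \in `I_M.+2) (wt x)%:E)%E).
  apply: lee_fsum_nneg_subset => //.
    by move=> x; rewrite !inE; exact: XM.
  by move=> x _; rewrite lee_fin wt_ge0.
rewrite fsumEFin; last exact: finite_II.
rewrite -fsbig_ord lee_fin; apply: le_trans (sum_wt_le M) _.
rewrite lerD2l ler_piMr ?ler0n // lerBlDr lerDl; exact/ltW/damp_gt0.
Qed.

Lemma psummable_wt_int : psummable setT (fun N : int => wt (absz N).+1).
Proof.
have bs : psummable [set: bool] (fun=> 1 : R).
  rewrite /psummable esum_fset; last by move=> b _; rewrite lee_fin.
    by rewrite fsumEFin ?ltry //; exact: finite_finset.
  exact: finite_finset.
have := @psummableM _ _ _ setT setT (fun _ : bool => 1 : R) wt _ _ bs psummable_wt.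
move=> /(_ _ _) prod_s.
(* The sign and the absolute value embed the integers in bool * nat. *)
pose e (N : int) := (N < 0, (absz N).+1).
apply: (@psummable_le _ _ _ _ ((fun p : bool * nat => 1 * wt p.2) \o e)).
  by move=> N _; rewrite /= mul1r.
apply: (psummable_inj (E := setT `*` setT)) => //.
- by move=> M N _ _ []; lia.
- by move=> p _; rewrite mul1r wt_ge0.
- by apply: prod_s => // i _; exact: wt_ge0.
Qed.

Definition seqs d : set (seq nat) := [set q | size q = d].

Lemma psummable_prod_wt d : psummable (seqs d) (fun q => \prod_(x <- q) wt x).
Proof.
elim: d => [|d IH].
  rewrite (_ : seqs 0 = [set [::]]); last first.
    by apply/seteqP; split=> [q /size0nil|q ->].
  by rewrite /psummable esum_set1 ?big_nil ?ltry // lee_fin.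
have e : set_bij ([set: nat] `*` seqs d) (seqs d.+1) (fun p => p.1 :: p.2).
  split.
  - by move=> [x q] [_ /= qd]; rewrite /seqs /= qd.
  - by move=> [x q] [y r] _ _ /= [-> ->].
  - by case=> [//|x q] [qd]; exists (x, q).
apply/(psummable_reindex _ e).
rewrite /comp /=; under eq_fun do rewrite big_cons.
apply: (@psummableM _ _ _ setT (seqs d) wt (fun q => \prod_(x <- q) wt x)) => //.
- by move=> x _; exact: wt_ge0.
- by move=> q _; apply: prodr_ge0 => x _; exact: wt_ge0.
- exact: psummable_wt.
Qed.

(** Starting the path at 0 forces the entries to be positive. *)
Definition inc_nat d : set (seq nat) := [set q | size q = d /\ path ltn 0%N q].

Lemma psummable_inc_nat_wt d : psummable (inc_nat d) (fun q => \prod_(x <- q) wt x).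
Proof.
apply: (@psummable_inj R _ _ (inc_nat d) (seqs d) id (fun q => \prod_(x <- q) wt x)) => //.
- by move=> q [].
- by move=> q _; apply: prodr_ge0 => x _; exact: wt_ge0.
- exact: psummable_prod_wt.
Qed.

End Weights.

(** * Coefficients of products of binomial series *)

Lemma prod_zip (V : comRingType) (T : Type) (x0 : T) (F : nat -> T -> V)
    (k : seq nat) (s : seq T) : size s = size k ->
  \prod_(p <- zip k s) F p.1 p.2 = \prod_(i < size k) F (nth 0%N k i) (nth x0 s i).
Proof.
move=> sk; rewrite (big_nth (0%N, x0)) big_mkord size_zip sk minnn.
by apply: eq_bigr => i _; rewrite nth_zip.
Qed.

Section SeriesCoefficients.
Variable F : numFieldType.
Implicit Types (M m a : nat) (k : seq nat) (d : seq F).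

Definition series M k d : {poly F} := \prod_(p <- zip k d) invpow_poly M p.1 p.2.

Lemma series_eqX M M' k d : (M <= M')%N -> eqX M (series M k d) (series M' k d).
Proof.
move=> MM; apply: eqX_prod => p _ i iM.
by rewrite !coef_poly iM (leq_trans iM).
Qed.

Lemma series_cons M e k x d :
  series M (e :: k) (x :: d) = invpow_poly M e x * series M k d.
Proof. by rewrite /series /= big_cons. Qed.

(** Replacing x and all the d by their opposites multiplies
prod (d + x)^(-k) by the sign (-1)^(sum of k). *)
Lemma coef_series_opp M k d a : size d = size k ->
  (series M k (map -%R d))`_a = (-1) ^+ (sumn k + a) * (series M k d)`_a.
Proof.
elim: k d a => [|e k IH] [|x d] a //=.
  move=> _; rewrite /series !big_nil coef1; case: a => [|a]; first by rewrite mulr1.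
  by rewrite mulr0.
move=> [dk]; rewrite !series_cons !coefM mulr_sumr; apply: eq_bigr => j _.
rewrite IH // !coef_poly; case: ifP => _; last by rewrite !mul0r mulr0.
rewrite /invpow_coef [(- x) ^+ _]exprNn invfM -exprVn invrN1.
have ja : (j <= a)%N by rewrite -ltnS ltn_ord.
have -> : (e + sumn k + a = (e + j) + (sumn k + (a - j)))%N by lia.
by rewrite [(-1) ^+ (_ + _ + _)]exprD; ring.
Qed.

Lemma coef_prod_poly (r m : nat) (c : 'I_r -> nat -> F) :
  (\prod_(i < r) \poly_(l < m.+1) c i l)`_m =
  \sum_(lam : r.-tuple 'I_m.+1 | is_composition lam) \prod_i c i (tnth lam i).
Proof.
under eq_bigr do rewrite poly_def.
rewrite bigA_distr_bigA /= coef_sum.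
pose t2f (t : r.-tuple 'I_m.+1) := [ffun i => tnth t i].
(* The terms of the expanded product are indexed by finite functions, the
   shifted zeta values by tuples. *)
pose f2t (f : {ffun 'I_r -> 'I_m.+1}) := [tuple f i | i < r].
rewrite (reindex t2f) /=; last first.
  exists f2t => [t _|f _]; first by apply: eq_from_tnth => i; rewrite tnth_mktuple ffunE.
  by apply/ffunP => i; rewrite ffunE tnth_mktuple.
rewrite [RHS]big_mkcond; apply: eq_bigr => t _ /=.
under eq_bigr do rewrite ffunE -mul_polyC.
rewrite big_split /= -rmorph_prod coefCM.
rewrite -(big_morph (fun n => 'X^n) (exprD _) (expr0 _)) coefXn /is_composition eq_sym.
by case: eqP => _; rewrite ?mulr1 ?mulr0.
Qed.

Lemma size_shift_index m k (lam : (size k).-tuple 'I_m.+1) :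
  size (shift_index lam) = size k.
Proof. by rewrite size_map size_zip size_tuple minnn. Qed.

Lemma nth_shift_index m k (lam : (size k).-tuple 'I_m.+1) (i : 'I_(size k)) :
  nth 0%N (shift_index lam) i = (nth 0%N k i + tnth lam i)%N.
Proof.
rewrite (nth_map (0%N, ord0)) ?size_zip ?size_tuple ?minnn //.
by rewrite nth_zip ?size_tuple //= -tnth_nth.
Qed.

(** Expanding the product gives the sum over compositions that defines the
shifted zeta values, before summation over the integers. *)
Lemma coef_series_shift m k d : size d = size k ->
  (series m.+1 k d)`_m =
  \sum_(lam : (size k).-tuple 'I_m.+1 | is_composition lam)
     (\prod_(i < size k) gbinom (- (nth 0%N k i)%:R) (tnth lam i)) *
     \prod_(p <- zip (shift_index lam) d) p.2 ^- p.1.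
Proof.
move=> dk; rewrite /series (prod_zip 0) // coef_prod_poly; apply: eq_bigr => lam _.
rewrite (prod_zip 0 (fun e x => x ^- e)) ?size_shift_index // -big_split /=.
by apply: eq_bigr => i _; rewrite nth_shift_index.
Qed.

End SeriesCoefficients.

Section ComplexCoefficients.
Context {R : realType}.
Notation normc := (@Normc.normc R).

Lemma normc_sum (K : Type) (s : seq K) (P : pred K) (G : K -> R[i]) :
  normc (\sum_(j <- s | P j) G j) <= \sum_(j <- s | P j) normc (G j).
Proof.
elim/big_rec2 : _ => [|j x y _ IH]; first by rewrite normc0.
by apply: le_trans (le_normcD _ _) _; rewrite lerD2l.
Qed.

Lemma normc_natr n : normc (n%:R) = n%:R.
Proof. by rewrite -(rmorph_nat (real_complex R)) normc_real normr_nat. Qed.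

(** Since |x| >= 1 for the integers x, the terms x^(-k-l) of the expansion are all
bounded by x^(-k). *)
Lemma series_bound M k : exists C : nat -> R, (forall a, 0 <= C a) /\
  forall (q : seq nat) a, size q = size k -> all (leq 1) q ->
    normc (series M k [seq x%:R | x <- q])`_a <= C a * \prod_(p <- zip k q) p.2%:R ^- p.1.
Proof.
elim: k => [|e k [C [C0 HC]]].
  exists (fun=> 1); split=> // -[|//] a _ _.
  rewrite /series /= !big_nil mulr1 coef1; case: a => [|a]; first by rewrite normc1.
  by rewrite normc0.
exists (fun a => \sum_(j < a.+1) normc (gbinom (- e%:R) j) * C (a - j)%N); split.
  by move=> a; apply: sumr_ge0 => j _; rewrite mulr_ge0 ?normc_ge0.
case=> [|x q] //= a [qk] /andP[x0 q0].
rewrite series_cons coefM big_cons /= mulr_suml; apply: le_trans (normc_sum _ _ _) _.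
apply: ler_sum => j _; rewrite normcM mulrACA ler_pM ?normc_ge0 //; last exact: HC.
rewrite coef_poly; case: ifP => _; last by rewrite normc0 mulr_ge0 ?normc_ge0 // invr_ge0 exprn_ge0.
rewrite /invpow_coef normcM ler_wpM2l ?normc_ge0 // normcV normcX normc_natr.
rewrite exprD invfM ler_piMr // ?invr_ge0 ?exprn_ge0 //.
by rewrite invf_le1 ?exprn_gt0 ?ltr0n // exprn_ege1 // ler1n.
Qed.

Definition zpow (k q : seq nat) : R := \prod_(p <- zip k q) p.2%:R ^- p.1.

Lemma zpow_ge0 k q : 0 <= zpow k q.
Proof. by apply: prodr_ge0 => p _; rewrite invr_ge0 exprn_ge0. Qed.

Lemma inc_nat_pos d q : inc_nat d q -> all (leq 1) q.
Proof. by move=> [_ /(order_path_min ltn_trans)]. Qed.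

Lemma path_le_last x q : path ltn x q -> all (geq (last x q)) (x :: q).
Proof.
elim: q x => [|y q IH] x /=; first by rewrite leqnn.
move=> /andP[xy /IH] /= /andP[yl ->]; rewrite yl !andbT.
exact: leq_trans (ltnW xy) yl.
Qed.

Lemma zpow_le_inv k q : is_index k -> size q = size k -> all (leq 1) q ->
  zpow k q <= \prod_(x <- q) x%:R^-1.
Proof.
elim: k q => [|e k IH] [|x q] //= ; first by rewrite /zpow !big_nil.
move=> /andP[e0 ki] [qk] /andP[x0 q0]; rewrite /zpow /= !big_cons /=.
apply: ler_pM; rewrite ?invr_ge0 ?exprn_ge0 ?zpow_ge0 //; last exact: IH.
rewrite lef_pV2 ?posrE ?exprn_gt0 ?ltr0n // -[leLHS]expr1.
by rewrite ler_weXn2l // ler1n.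
Qed.

Lemma admissible_last e k : admissible (rcons k e) -> is_index k /\ (2 <= e)%N.
Proof.
rewrite /admissible /is_index all_rcons last_rcons => /andP[/andP[_ ki] /orP[|e2]] //.
by case: (k).
Qed.

(** The last exponent being at least 2, the largest entry has a factor to spare. *)
Lemma zpow_le_last k q : admissible k -> k != [::] -> size q = size k ->
  all (leq 1) q -> zpow k q * (last 0%N q)%:R <= \prod_(x <- q) x%:R^-1.
Proof.
case/lastP: k => // k e /admissible_last[ki e2] _.
case/lastP: q => [|q z]; rewrite ?size_rcons // => -[qk].
rewrite all_rcons last_rcons => /andP[z0 q0].
rewrite /zpow zip_rcons // !big_rcons /= -mulrA; apply: ler_pM.
- exact: zpow_ge0.
- by rewrite mulr_ge0 ?invr_ge0 ?exprn_ge0.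
- exact: zpow_le_inv.
have z1 : 1 <= z%:R :> R by rewrite ler1n.
have zp : 0 < z%:R :> R by rewrite ltr0n.
case: e e2 => [|[|e]] // _; rewrite exprSr invfM mulrVK ?unitfE ?gt_eqF //.
rewrite lef_pV2 ?posrE ?exprn_gt0 // -[leLHS]expr1.
by rewrite ler_weXn2l.
Qed.
End ComplexCoefficients.

(** * Multiple zeta values of admissible indices *)

Section ZetaValues.
Context {R : realType}.
Notation normc := (@Normc.normc R).

Lemma zpow_le_wt k q : admissible k -> inc_nat (size k) q ->
  zpow k q <= \prod_(x <- q) wt (size k).+1 x :> R.
Proof.
move=> ka [qk qpath]; have q1 : all (leq 1) q by apply: (@inc_nat_pos (size k)).
have [k0|k0] := eqVneq k [::].
  by move: qk; rewrite k0 => /size0nil ->; rewrite /zpow !big_nil.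
have l0 : (0 < last 0%N q)%N.
  case: q qk q1 {qpath} => [|x q] /=; first by move/eqP; rewrite eq_sym size_eq0 (negPf k0).
  by move=> _ q1; apply: (allP (q1 : all (leq 1) (x :: q))); rewrite mem_last.
have lR : 0 < (last 0%N q)%:R :> R by rewrite ltr0n.
have := zpow_le_last (R := R) ka k0 qk q1; rewrite -ler_pdivlMr // => /le_trans; apply.
rewrite /wt big_split /= mulrC ler_wpM2r //.
  by apply: prodr_ge0 => x _; rewrite invr_ge0.
apply: inv_le_prod_damp => //; last by rewrite qk.
by have /andP[_] := path_le_last qpath.
Qed.

Lemma psummable_zpow k : admissible k -> psummable (inc_nat (size k)) (zpow (R := R) k).
Proof.
move=> ka; apply: psummable_le (@psummable_inc_nat_wt R (size k).+1 isT (size k)) => q.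
exact: zpow_le_wt.
Qed.

Lemma inc_nat_bij d : set_bij [set n : d.-tuple nat | sorted ltn (0%N :: n)] (inc_nat d)
  (fun n => tval n).
Proof.
split.
- by move=> n /= nP; split=> //; exact: size_tuple.
- by move=> n n' _ _ /val_inj.
- by move=> q [qd qP]; exists (Tuple (introT eqP qd)).
Qed.

Lemma mzv_sumE k : mzv_sum (R := R) k = (\esum_(q in inc_nat (size k)) (zpow k q)%:E)%E.
Proof.
rewrite (reindex_esum _ _ _ _ (inc_nat_bij (size k))) /mzv_sum.
apply: eq_esum => n _; congr (_%:E); rewrite /zpow.
rewrite (prod_zip 0%N (fun e x => x%:R ^- e)) ?size_tuple //.
by apply: eq_bigr => i _; rewrite -tnth_nth.
Qed.

Lemma mzv_convergent_admissible k : admissible k -> @mzv_convergent R k.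
Proof. by move=> /psummable_zpow; rewrite /mzv_convergent mzv_sumE. Qed.

Lemma csum_real (I : choiceType) (D : set I) (f : I -> R) :
  csum D (fun i => (f i)%:C%C) = (rsum D f)%:C%C.
Proof.
rewrite /csum /= -[RHS]/(Complex _ _); congr Complex.
by have := @csum0 R I D => -[].
Qed.

Definition zprod (k q : seq nat) : R[i] := \prod_(p <- zip k [seq x%:R | x <- q]) p.2 ^- p.1.

Lemma zprodE k q : zprod k q = (zpow k q)%:C%C.
Proof.
rewrite /zprod /zpow rmorph_prod.
have -> : zip k [seq x%:R : R[i] | x <- q] = [seq (p.1, p.2%:R) | p <- zip k q].
  by elim: k q => [|e k IH] [|x q] //=; rewrite IH.
rewrite big_map; by apply: eq_bigr => -[e x] _ /=; rewrite fmorphV rmorphXn rmorph_nat.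
Qed.

Lemma mzvE k : admissible k -> (mzv k)%:C%C = csum (inc_nat (size k)) (zprod k).
Proof.
move=> ka; rewrite (eq_csum (fun q _ => zprodE k q)) csum_real rsum_ge0E.
- by rewrite /mzv mzv_sumE.
- by move=> q _; exact: zpow_ge0.
- exact: psummable_zpow.
Qed.

Lemma admissible_shift m k (lam : (size k).-tuple 'I_m.+1) :
  admissible k -> admissible (shift_index lam).
Proof.
rewrite /admissible -!size_eq0 size_shift_index => /andP[ki kl].
apply/andP; split.
  apply/(all_nthP 0%N) => i; rewrite size_shift_index => ik.
  rewrite (nth_shift_index lam (Ordinal ik)) ltn_addr //=.
  exact: (all_nthP 0%N ki).
case/orP: kl => [/eqP ->//|kl]; apply/orP.
case: (posnP (size k)) => [_|k0]; [by left|right].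
have sk : ((size k).-1 < size k)%N by rewrite prednK.
rewrite -nth_last size_shift_index (nth_shift_index lam (Ordinal sk)) /= ltn_addr //.
by rewrite nth_last.
Qed.

Lemma csummable_series M m k : admissible k ->
  csummable (inc_nat (size k)) (fun q => (series M k [seq x%:R : R[i] | x <- q])`_m).
Proof.
move=> ka; have [C [C0 HC]] := @series_bound R M k.
apply: (csummable_le (g := fun q => C m * zpow k q)).
  by move=> q [qk qP]; apply: HC => //; apply: (@inc_nat_pos (size k)).
apply: psummableZ => //; first by move=> q _; exact: zpow_ge0.
exact: psummable_zpow.
Qed.

(** The finite sum over compositions is exchanged with the sums that define the
zeta values, all of which converge because the index is admissible. *)
Lemma mzv_reg_shiftE (T : R[i]) M m k : admissible k -> (m < M)%N ->
  mzv_reg_shift T m k =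
  csum (inc_nat (size k)) (fun q => (series M k [seq x%:R | x <- q])`_m).
Proof.
move=> ka mM.
transitivity (csum (inc_nat (size k)) (fun q => \sum_(lam : (size k).-tuple 'I_m.+1 | is_composition lam)
     (\prod_(i < size k) gbinom (- (nth 0%N k i)%:R) (tnth lam i)) *
     zprod (shift_index lam) q)); last first.
  apply: eq_csum => q [qk _]; rewrite -(series_eqX _ _ mM) //.
  by rewrite coef_series_shift ?size_map.
have lam_s (lam : (size k).-tuple 'I_m.+1) :
    csummable (inc_nat (size k)) (zprod (shift_index lam)).
  have sa := admissible_shift lam ka.
  rewrite -(size_shift_index lam); apply: csummable_le (psummable_zpow sa) => q _.
  by rewrite zprodE normc_real ger0_norm // zpow_ge0.
rewrite csum_sum => [|lam _]; last exact: csummableZ.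
apply: eq_bigr => lam _; rewrite csumZ //; congr (_ * _).
have sa := admissible_shift lam ka.
by rewrite mzv_reg_admissible // mzvE // size_shift_index.
Qed.

End ZetaValues.

(** * An increasing tuple seen from one of its entries *)

Section Expansion.

Definition inc_int d : set (seq int) := [set n | size n = d /\ sorted <%R n].

Lemma inc_int_bij d : set_bij [set n : d.-tuple int | sorted <%R n] (inc_int d)
  (fun n => tval n).
Proof.
split.
- by move=> n /= nP; split=> //; exact: size_tuple.
- by move=> n n' _ _ /val_inj.
- by move=> q [qd qP]; exists (Tuple (introT eqP qd)).
Qed.

(** The tuple with entry N, with distances q to the entries on its left and p to
those on its right, each listed from the nearest to the farthest. *)
Definition unfold_at (x : (seq nat * seq nat) * int) : seq int :=
  rev [seq x.2 - a%:Z | a <- x.1.1] ++ x.2 :: [seq x.2 + a%:Z | a <- x.1.2].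

Lemma unfold_at_sorted q p (N : int) :
  sorted <%R (unfold_at ((q, p), N)) = path ltn 0%N q && path ltn 0%N p.
Proof.
rewrite /unfold_at sorted_cat_cons /= -rev_cons rev_sorted /=.
congr andb.
  rewrite -(@mono_path _ _ (fun a : nat => N - a%:Z) ltn (fun x y => y < x)) ?subr0 //.
  by move=> a b /=; rewrite ltrD2l ltrN2.
rewrite -(@mono_path _ _ (fun a : nat => N + a%:Z) ltn <%R) ?addr0 //.
by move=> a b /=; rewrite ltrD2l.
Qed.

Lemma unfold_at_bij d j : (j < d)%N ->
  set_bij ((inc_nat j `*` inc_nat (d - j.+1)) `*` [set: int]) (inc_int d) unfold_at.
Proof.
move=> jd; split.
- move=> [[q p] N] [[[qj qP] [pj pP]] _] /=; split; last first.
    by rewrite unfold_at_sorted qP.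
  rewrite /unfold_at size_cat size_rev /= !size_map qj pj; lia.
- move=> [[q p] N] [[q' p'] N'] /set_mem [[[/= qj _] _] _] /set_mem [[[/= qj' _] _] _].
  rewrite /unfold_at /= => /eqP; rewrite eqseq_cat ?size_rev ?size_map ?qj ?qj' //.
  move=> /andP[/eqP/(can_inj revK) qq /eqP[NN]]; rewrite -{}NN in qq *.
  move=> pp; congr ((_, _), _).
    by apply: inj_map qq => a b; lia.
  by apply: inj_map pp => a b; lia.
- move=> n [nd nP]; set N := nth 0 n j.
  pose q := [seq absz (N - y) | y <- rev (take j n)].
  pose p := [seq absz (y - N) | y <- drop j.+1 n].
  have nE : n = take j n ++ N :: drop j.+1 n.
    by rewrite -[LHS](cat_take_drop j) (drop_nth 0) // nd.
  have := nP; rewrite nE sorted_cat_cons -[rcons _ _]revK rev_rcons rev_sorted /=.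
  move=> /andP[lP rP].
  have qE : [seq N - a%:Z | a <- q] = rev (take j n).
    rewrite -map_comp -[RHS]map_id; apply/eq_in_map => y yn /=.
    have /allP/(_ _ yn) : all (<%R^~ N) (rev (take j n)).
      by apply: order_path_min lP => a b c; rewrite /= => ab ca; exact: lt_trans ab.
    by move=> /=; lia.
  have pE : [seq N + a%:Z | a <- p] = drop j.+1 n.
    rewrite -map_comp -[RHS]map_id; apply/eq_in_map => y yn /=.
    have /allP/(_ _ yn) : all (<%R N) (drop j.+1 n).
      by apply: order_path_min rP => a b c; exact: lt_trans.
    by move=> /=; lia.
  have uE : unfold_at ((q, p), N) = n by rewrite /unfold_at /= qE pE revK -nE.
  exists ((q, p), N) => //; have := nP; rewrite -{1}uE unfold_at_sorted => /andP[qP pP].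
  split=> //=; split; split=> //.
    by rewrite size_map size_rev size_take nd jd.
  by rewrite size_map size_drop nd.
  by rewrite -nE.
Qed.

End Expansion.

(** * The simple poles *)

Section Kernel.
Context {R : realType}.
Notation normc := (@Normc.normc R).

Lemma zpow_last_le k q : admissible k -> size q = size k -> all (leq 1) q ->
  zpow k q * (last 0%N q)%:R <= \prod_(x <- q) x%:R^-1 :> R.
Proof.
move=> ka qk q1; have [k0|k0] := eqVneq k [::]; last exact: zpow_le_last.
by move: qk; rewrite k0 => /size0nil ->; rewrite big_nil mulr0.
Qed.

(** Here y is the larger of x and y, so that 1/y <= 2 / max(x, l), because
l <= x + y <= 2 y; this spare factor is spread over x and the entries of q. *)
Lemma kernel_bound_le (x y l : nat) (q : seq nat) : (0 < x)%N -> (x <= y)%N ->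
  (l <= x + y)%N -> all (geq l) q ->
  (x%:R * y%:R)^-1 * \prod_(a <- q) a%:R^-1
    <= 2 * wt (size q).+1 x * \prod_(a <- q) wt (size q).+1 a :> R.
Proof.
move=> x0 xy lxy ql; pose z := maxn x l.
have y0 : (0 < y)%N by exact: leq_trans xy.
have z0 : (0 < z)%N by rewrite leq_max x0.
have zs : all (geq z) (x :: q).
  rewrite /= leq_maxl /=; apply: sub_all ql => a /= al.
  by apply: leq_trans al _; exact: leq_maxr.
have yz : y%:R^-1 <= 2 * z%:R^-1 :> R.
  rewrite -ler_pdivrMl // -invfM lef_pV2 ?posrE ?mulr_gt0 ?ltr0n //.
  by rewrite -natrM ler_nat geq_max; apply/andP; split; lia.
have := @inv_le_prod_damp R (size q).+1 isT z _ z0 zs (leqnn _).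
rewrite big_cons => zd.
have P0 : 0 <= \prod_(a <- q) a%:R^-1 :> R.
  by apply: prodr_ge0 => a _; rewrite invr_ge0.
rewrite /wt big_split /= invfM.
have -> : 2 * (damp (size q).+1 x / x%:R) *
    (\prod_(i <- q) damp (size q).+1 i * \prod_(i <- q) i%:R^-1) =
  x%:R^-1 * (2 * (damp (size q).+1 x * \prod_(i <- q) damp (size q).+1 i))
    * \prod_(i <- q) i%:R^-1 :> R by ring.
rewrite ler_wpM2r // ler_wpM2l ?invr_ge0 //.
by apply: le_trans yz _; rewrite ler_wpM2l.
Qed.

Lemma kernel_bound (x y l : nat) (q : seq nat) : (0 < x)%N -> (0 < y)%N ->
  (l <= x + y)%N -> all (geq l) q ->
  (x%:R * y%:R)^-1 * \prod_(a <- q) a%:R^-1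
    <= 2 * (wt (size q).+1 x + wt (size q).+1 y)
       * \prod_(a <- q) wt (size q).+1 a :> R.
Proof.
move=> x0 y0 lxy ql.
have P0 : 0 <= \prod_(a <- q) wt (size q).+1 a :> R.
  by apply: prodr_ge0 => a _; exact: wt_ge0.
have [xy|/ltnW yx] := leqP x y.
  apply: le_trans (kernel_bound_le x0 xy lxy ql) _.
  by rewrite ler_wpM2r // ler_wpM2l // lerDl wt_ge0.
rewrite [x%:R * _]mulrC; rewrite addnC in lxy.
apply: le_trans (kernel_bound_le y0 yx lxy ql) _.
by rewrite ler_wpM2r // ler_wpM2l // lerDr wt_ge0.
Qed.

Section Translates.
Variable s : R[i].
Hypothesis sZ : forall n : int, s <> n%:~R.

Lemma shift_neq0 (N : int) : N%:~R + s != 0.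
Proof. by rewrite addrC addr_eq0 -rmorphN; apply/eqP; exact: sZ. Qed.

Lemma inv_shift_bound : exists2 c : R, 0 < c &
  forall N : int, normc (N%:~R + s)^-1 <= c / (absz N).+1%:R.
Proof.
have [c c0 cN] := normc_intD_ge sZ; exists c^-1; first by rewrite invr_gt0.
move=> N; rewrite normcV -invfM lef_pV2 ?posrE ?mulr_gt0 ?ltr0n //.
by apply: lt_le_trans (cN N); rewrite mulr_gt0 ?ltr0n.
Qed.

Lemma psummable_inv2 : psummable setT (fun N : int => (absz N).+1%:R ^- 2 : R).
Proof.
apply: psummable_le (@psummable_wt_int R 1 isT) => N _.
rewrite /wt -exprVn expr2 ler_wpM2r ?invr_ge0 //.
by have := @inv_le_dampX R 1 isT (absz N).+1 isT; rewrite expr1.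
Qed.

Lemma csummable_pow e : (2 <= e)%N ->
  csummable setT (fun N : int => (N%:~R + s) ^- e).
Proof.
move=> e2; have [c c0 cN] := inv_shift_bound.
apply: (csummable_le (g := fun N : int => c ^+ e * (absz N).+1%:R ^- 2)).
  move=> N _; rewrite -[(_ + s) ^- e]exprVn normcX; apply: (@le_trans _ _ ((c / (absz N).+1%:R) ^+ e)).
    by rewrite lerXn2r ?nnegrE ?normc_ge0 ?divr_ge0 // ltW.
  rewrite exprMn exprVn ler_wpM2l ?exprn_ge0 // ?(ltW c0) //.
  by rewrite lef_pV2 ?posrE ?exprn_gt0 ?ltr0n // ler_weXn2l // ler1n.
by apply: psummableZ psummable_inv2; [rewrite exprn_ge0 // ltW|move=> N _; rewrite invr_ge0 exprn_ge0].
Qed.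

(** The simple pole at N, compensated by the one at N - l. *)
Definition gap (l : nat) (N : int) : R[i] :=
  (N%:~R + s)^-1 - ((N - l%:Z)%:~R + s)^-1.

Lemma normc_gap c (l : nat) (N : int) : 0 < c ->
  (forall N : int, normc (N%:~R + s)^-1 <= c / (absz N).+1%:R) ->
  normc (gap l N) <= c ^+ 2 * (l%:R * ((absz N).+1%:R * (absz (N - l%:Z)%R).+1%:R)^-1).
Proof.
move=> c0 cN.
have -> : gap l N = - (l%:R * ((N%:~R + s)^-1 * ((N - l%:Z)%:~R + s)^-1)).
  rewrite /gap; have a0 := shift_neq0 N; have b0 := shift_neq0 (N - l%:Z).
  have -> : l%:R = (N%:~R + s) - ((N - l%:Z)%:~R + s) :> R[i].
    by rewrite opprD addrACA subrr addr0 -rmorphB opprB addrC subrK.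
  move: a0 b0; move: (N%:~R + s) ((N - l%:Z)%:~R + s) => a b a0 b0.
  by field; rewrite a0 b0.
rewrite normcN 2!normcM normc_natr.
rewrite [leRHS](_ : _ = l%:R * ((c / (absz N).+1%:R) * (c / (absz (N - l%:Z)%R).+1%:R))).
  by rewrite ler_wpM2l // ler_pM // normc_ge0.
by rewrite invfM expr2; ring.
Qed.

Lemma shift_bij (l : int) : set_bij [set: int] [set: int] (fun N => N - l).
Proof.
split=> // [M N _ _ /addIr//|N _]; exists (N + l) => //=; exact: addrK.
Qed.

(** For l = 1 the sum telescopes; the gap of length l + 1 is the sum of one of
length l and of a translate of one of length 1. *)
Lemma csum_gap l : csummable setT (gap l) /\ csum setT (gap l) = 0.
Proof.
have [c c0 cN] := inv_shift_bound.
have gap1_s : csummable setT (gap 1).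
  apply: (csummable_le (g := fun N : int => (c ^+ 2 * 2) * (absz N).+1%:R ^- 2)).
    move=> N _; apply: le_trans (normc_gap 1 N c0 cN) _.
    rewrite mul1r -mulrA ler_wpM2l ?exprn_ge0 ?(ltW c0) //.
    rewrite expr2 !invfM mulrCA ler_wpM2l ?invr_ge0 //.
    rewrite -ler_pdivrMl // -invfM lef_pV2 ?posrE ?mulr_gt0 ?ltr0n //.
    by rewrite -natrM ler_nat; lia.
  apply: psummableZ psummable_inv2; first by rewrite mulr_ge0 // exprn_ge0 // ltW.
  by move=> N _; rewrite invr_ge0 exprn_ge0.
have gap1_0 : csum setT (gap 1) = 0.
  apply: (csum_telescope (h := fun N => (N%:~R + s)^-1)) => // e e0.
  pose K := Num.bound (c / e).
  have KP : c / e < K%:R by apply: archi_boundP; rewrite divr_ge0 ?ltW.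
  have ce (M : nat) (N : int) : (K <= M)%N -> absz N = M -> normc (N%:~R + s)^-1 <= e.
    move=> KM NM; apply: le_trans (cN N) _; rewrite NM ler_pdivrMr ?ltr0n //.
    rewrite mulrC -ler_pdivrMr //; apply: le_trans (ltW KP) _.
    by rewrite ler_nat leqW.
  by exists K => M KM; split; apply: (ce M) => //; rewrite abszN.
elim: l => [|l [IHs IH0]].
  have g0 N : gap 0 N = 0 by rewrite /gap subr0 subrr.
  by rewrite (_ : gap 0 = fun=> 0); [split; [exact: csummable0|exact: csum0]|apply/funext].
have gE : gap l.+1 = fun N => gap l N + (gap 1 \o (fun N => N - l%:Z)) N.
  apply/funext => N; rewrite /gap /= addrA subrK; congr (_ - (_%:~R + _)^-1).
  by lia.
have g1s : csummable setT (gap 1 \o (fun N => N - l%:Z)).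
  exact: (proj1 (csummable_reindex _ (shift_bij l%:Z)) gap1_s).
rewrite gE; split; first exact: csummableD.
by rewrite csumD // IH0 add0r -(csum_reindex _ (shift_bij l%:Z)).
Qed.

End Translates.
End Kernel.

(** * Summing the partial fractions *)

Section Residues.
Variables (F : numFieldType) (I : finType) (y : I -> F) (M : nat).
Hypothesis y_inj : injective y.
Variable k : {ffun I -> nat}.
Hypothesis k_pos : forall i, (0 < k i)%N.
Hypothesis kM : forall i, (k i <= M)%N.

Lemma principal_partE (H : {ffun I -> nat} -> F) j :
  principal_part y M H k j =
  \sum_(m < (k j).-1) H (single j (k j - m)) * local_coef y M k j m
  + H (single j 1) * local_coef y M k j (k j).-1.
Proof.
rewrite /principal_part; case: (k j) (k_pos j) => // e _.
by rewrite big_ord_recr /= subSnn.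
Qed.

(** The indicator of total exponent 1 satisfies the recursion of
[partial_fractions]: all the terms vanish in total exponent at least 3, and the
two on the right are equal in total exponent 2. On multiples of unit vectors it
selects the simple poles. *)
Lemma sum_residues : (2 <= \sum_i k i)%N ->
  \sum_j local_coef y M k j (k j).-1 = 0.
Proof.
(* For nonzero e, H(e) is the coefficient of 1/s in the expansion at infinity of
   prod_i (y_i + s)^(-e_i). *)
move=> k2; pose H (e : {ffun I -> nat}) : F := (\sum_i e i == 1)%N%:R.
have Hs j e : H (single j e) = (e == 1%N)%:R.
  rewrite /H (bigD1 j) //= ffunE eqxx big1 ?addn0 // => i /negPf ij.
  by rewrite ffunE ij.
have Hrec (e : {ffun I -> nat}) a b : a != b -> (0 < e a)%N -> (0 < e b)%N ->
    (y b - y a) * H e = H (decr e b) - H (decr e a).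
  move=> ab ea eb; rewrite /H; have Ea := sum_decr ea; have Eb := sum_decr eb.
  have : (0 < \sum_i decr e b i)%N.
    by rewrite (bigD1 a) //= ffunE (negPf ab) subn0 ltn_addr.
  rewrite Eb in Ea *; move: Ea => [->]; case: (\sum_i _)%N => // n _.
  by rewrite subrr mulr0.
transitivity (\sum_j principal_part y M H k j); last first.
  by rewrite -(partial_fractions y_inj Hrec (ltnW k2) kM) /H gtn_eqF.
apply: eq_bigr => j _; rewrite principal_partE Hs eqxx mul1r big1 ?add0r // => m _.
by rewrite Hs gtn_eqF ?mul0r //; have := ltn_ord m; lia.
Qed.

Lemma prod_partial_fractions : (forall i, y i != 0) -> (0 < \sum_i k i)%N ->
  \prod_i y i ^- k i =
  \sum_j (\sum_(m < (k j).-1) y j ^- (k j - m) * local_coef y M k j m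
          + (y j)^-1 * local_coef y M k j (k j).-1).
Proof.
move=> y0 k0; pose H (e : {ffun I -> nat}) : F := \prod_i y i ^- e i.
have Hs j e : H (single j e) = y j ^- e.
  rewrite /H (bigD1 j) //= ffunE eqxx big1 ?mulr1 // => i /negPf ij.
  by rewrite ffunE ij expr0 invr1.
have Hdecr (e : {ffun I -> nat}) b : (0 < e b)%N -> H (decr e b) = y b * H e.
  move=> eb; rewrite /H (bigD1 b) //= [in RHS](bigD1 b) //= mulrA; congr (_ * _).
    rewrite ffunE eqxx; case: (e b) eb => // n _.
    by rewrite subSS subn0 exprS invfM mulVKf.
  by apply: eq_bigr => i /negPf ib; rewrite ffunE ib subn0.
rewrite -/(H k) (partial_fractions y_inj (M := M)) //; last first.
  by move=> e a b ab ea eb; rewrite !Hdecr // mulrBl.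
apply: eq_bigr => j _; rewrite principal_partE Hs expr1; congr (_ + _).
by apply: eq_bigr => m _; rewrite Hs.
Qed.

(** As the residues add up to 0, the same multiple of them may be subtracted from
each simple pole. *)
Lemma prod_partial_fractions_regular (j0 : I) :
  (forall i, y i != 0) -> (2 <= \sum_i k i)%N ->
  \prod_i y i ^- k i =
  \sum_j (\sum_(m < (k j).-1) y j ^- (k j - m) * local_coef y M k j m
          + local_coef y M k j (k j).-1 * ((y j)^-1 - (y j0)^-1)).
Proof.
move=> y0 k2; rewrite prod_partial_fractions //; last exact: ltnW.
under [RHS]eq_bigr do rewrite mulrBr addrA [_ / y _]mulrC.
by rewrite [RHS]big_split /= sumrN -mulr_suml sum_residues // mul0r oppr0 addr0.
Qed.

End Residues.

Lemma big_ord_neq (V : comRingType) r j (G : nat -> V) : (j < r)%N ->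
  \prod_(i < r | i != j :> nat) G i =
    (\prod_(i < j) G i) * \prod_(i < r - j.+1) G (j.+1 + i)%N.
Proof.
move=> jr; rewrite -(big_mkord (fun i => i != j) G) (@big_cat_nat _ _ _ j) //=; last exact: ltnW.
congr (_ * _).
  rewrite big_nat_cond (eq_bigl (fun i => 0 <= i < j)%N); last first.
    by move=> i; case: (ltngtP i j); rewrite ?andbF ?andbT.
  by rewrite -big_nat big_mkord.
rewrite big_ltn_cond // eqxx /= -{1}[j.+1]add0n big_addn big_mkord.
rewrite [LHS](eq_bigl xpredT) => [|i]; last by rewrite /= addnS gtn_eqF // ltnS leq_addl.
by apply: eq_bigr => i _; rewrite addnC.
Qed.

Section Assembly.
Context {R : realType}.
Notation normc := (@Normc.normc R).
Notation C := R[i].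
Variable k : seq nat.
Hypothesis k_index : is_index k.
Hypothesis k_first : (2 <= head 0 k)%N.
Hypothesis k_last : (2 <= last 0 k)%N.

Lemma admissible_left j : admissible (rev (take j k)).
Proof.
rewrite /admissible /is_index all_rev.
have -> /= : all (leq 1) (take j k).
  by move: k_index; rewrite -{1}(cat_take_drop j k) /is_index all_cat => /andP[].
case: j k k_first => [|j] [|e k'] //= e2.
by rewrite rev_cons last_rcons e2 orbT.
Qed.

Lemma admissible_right j : admissible (drop j k).
Proof.
move: k_index k_last; rewrite -{1 2}(cat_take_drop j k) /is_index all_cat last_cat.
rewrite /admissible /is_index => /andP[_ ->] /=.
by case: (drop j k) => //= e k' ->; rewrite orbT.
Qed.

Let M := (sumn k).+1.
Let r := size k.

Lemma size_gt0 : (0 < r)%N.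
Proof. by rewrite /r; case: k k_first. Qed.

Lemma nth_le_M i : (nth 0%N k i <= M)%N.
Proof.
rewrite /M; elim: (k) i => [|e k' IH] [|i] //=; first by rewrite leqW // leq_addr.
by apply: leq_trans (IH i) _; rewrite ltnS leq_addl.
Qed.

(** The coefficient [local_coef] as a function of the distances x.1 on the left
and x.2 on the right of the j-th entry. The entries on the left are listed
from the nearest, which is why the left part of the index is reversed. *)
Definition interaction j m (x : seq nat * seq nat) : C :=
  (series M (rev (take j k)) (map -%R [seq a%:R | a <- x.1])
   * series M (drop j.+1 k) [seq a%:R | a <- x.2])`_m.

Definition sides j : set (seq nat * seq nat) := inc_nat j `*` inc_nat (r - j.+1).

Lemma size_left j : (j < r)%N -> size (rev (take j k)) = j.
Proof. by move=> jr; rewrite size_rev size_takel // ltnW. Qed.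

Lemma size_right j : size (drop j.+1 k) = (r - j.+1)%N.
Proof. by rewrite size_drop. Qed.

Lemma interactionE j m x : (j < r)%N -> sides j x -> interaction j m x =
  \sum_(a < m.+1) (-1) ^+ (weight (take j k) + a)
    * ((series M (rev (take j k)) [seq b%:R | b <- x.1])`_a
       * (series M (drop j.+1 k) [seq b%:R | b <- x.2])`_(m - a)).
Proof.
move=> jr [[x1 _] _]; rewrite /interaction coefM; apply: eq_bigr => a _.
rewrite coef_series_opp; last by rewrite size_map x1 size_left.
by rewrite sumn_rev mulrA.
Qed.

(** The two sides are summed independently. As the sum over the sides does not
mention T, this also shows that the coefficient is independent of T. *)
Lemma csum_interaction T j m : (j < r)%N -> (m < M)%N ->
  csummable (sides j) (interaction j m) /\
  csum (sides j) (interaction j m) = tangent_coef T k j m.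
Proof.
move=> jr mM.
have term a : (a < m.+1)%N ->
    let f := fun x : seq nat * seq nat =>
       (series M (rev (take j k)) [seq b%:R : C | b <- x.1])`_a
       * (series M (drop j.+1 k) [seq b%:R : C | b <- x.2])`_(m - a) in
    csummable (sides j) f /\ csum (sides j) f =
      mzv_reg_shift T a (rev (take j k)) * mzv_reg_shift T (m - a) (drop j.+1 k).
  move=> am; have := @csum_mul R _ _ (inc_nat j) (inc_nat (r - j.+1))
    (fun q => (series M (rev (take j k)) [seq b%:R : C | b <- q])`_a)
    (fun p => (series M (drop j.+1 k) [seq b%:R : C | b <- p])`_(m - a)).
  rewrite (@mzv_reg_shiftE _ T M) ?admissible_left //; last by apply: leq_trans mM.
  rewrite (@mzv_reg_shiftE _ T M) ?admissible_right //; last first.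
    by apply: leq_ltn_trans mM; exact: leq_subr.
  rewrite size_left // size_right; apply.
    by have := csummable_series (R := R) M a (admissible_left j); rewrite size_left.
  by have := csummable_series (R := R) M (m - a) (admissible_right j.+1); rewrite size_right.
have sE := eq_csum (fun x => @interactionE j m x jr).
split.
  apply: (eq_csummable (fun x => @interactionE j m x jr)).
  by apply: csummable_sum => a _; apply: csummableZ; have [] := term a (ltn_ord a).
rewrite sE csum_sum => [|a _]; last first.
  by apply: csummableZ; have [] := term a (ltn_ord a).
apply: eq_bigr => a _; have [ts tE] := term a (ltn_ord a).
by rewrite csumZ // tE mulrA.
Qed.

Section AtPoint.
Variable s : C.
Hypothesis sZ : forall n : int, s <> n%:~R.

Definition node (n : seq int) (i : 'I_r) : C := (nth 0 n i)%:~R + s.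
Definition exponents : {ffun 'I_r -> nat} := [ffun i : 'I_r => nth 0%N k i].

Lemma node_inj n : inc_int r n -> injective (node n).
Proof.
move=> [nr nP] i i' /addIr /eqP; rewrite eqr_int nth_uniq ?nr ?ltn_ord //.
  by move=> /eqP /val_inj.
exact: (sorted_uniq lt_trans (@ltxx _ _)).
Qed.

Lemma local_coef_unfold (j : 'I_r) m x : (sides j `*` setT) x ->
  local_coef (node (unfold_at x)) M exponents j m = interaction j m x.1.
Proof.
case: x => [[q p] N] [[[/= qj qP] [pj pP]] _].
pose D := [seq (z - N)%:~R : C | z <- unfold_at ((q, p), N)].
pose A (e : nat) (d : C) := invpow_poly M e d.
have sD : size D = size k.
  rewrite size_map /unfold_at size_cat size_rev /= !size_map qj pj.
  by have := ltn_ord j; rewrite /r; lia.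
(* D lists the differences from the j-th entry: opposite distances on the left,
   then 0, then the distances on the right. *)
have DE : D = rev (map -%R [seq a%:R | a <- q]) ++ 0 :: [seq a%:R | a <- p].
  rewrite /D /unfold_at map_cat map_rev /= subrr -!map_comp; congr (rev _ ++ _ :: _).
    by apply: eq_map => a /=; rewrite addrAC subrr add0r rmorphN.
  by apply: eq_map => a /=; rewrite addrAC subrr add0r.
have tD : take j D = rev (map -%R [seq a%:R | a <- q]).
  by rewrite DE take_size_cat // size_rev !size_map.
have dD : drop j.+1 D = [seq a%:R | a <- p].
  rewrite DE -cat_rcons drop_size_cat // size_rcons size_rev !size_map qj //.
rewrite /local_coef /interaction; congr (polyseq _)`_m.
have Nj : nth 0 (unfold_at ((q, p), N)) j = N.
  by rewrite /unfold_at nth_cat size_rev size_map qj ltnn subnn.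
rewrite (eq_bigr (fun i : 'I_r => A (nth 0%N k i) (nth 0 D i))); last first.
  move=> i _; rewrite /A ffunE; congr invpow_poly.
  rewrite (nth_map 0) -?(size_map (fun z => (z - N)%:~R : C)) ?sD //.
  by rewrite /node Nj opprD addrACA subrr addr0 -rmorphB.
rewrite (big_ord_neq (fun i => A (nth 0%N k i) (nth 0 D i))) //.
congr (_ * _).
  have tk : size (take j D) = size (take j k).
    by rewrite !size_takel // ?sD ltnW // ltn_ord.
  rewrite -[map -%R _]revK -tD /series -rev_zip //.
  rewrite [RHS](perm_big (zip (take j k) (take j D))) ?perm_rev //=.
  rewrite (prod_zip 0 A) // size_takel; last exact/ltnW/ltn_ord.
  by apply: eq_bigr => i _; rewrite !nth_take.
rewrite -dD /series (prod_zip 0 A) ?size_drop ?sD //.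
by apply: eq_bigr => i _; rewrite !nth_drop.
exact: ltn_ord.
Qed.

Lemma interaction_bound j m : (j < r)%N -> exists2 c : R, 0 <= c &
  forall x, sides j x -> normc (interaction j m x)
    <= c * (zpow (rev (take j k)) x.1 * zpow (drop j.+1 k) x.2).
Proof.
move=> jr; have [cl [cl0 cl_le]] := @series_bound R M (rev (take j k)).
have [cr [cr0 cr_le]] := @series_bound R M (drop j.+1 k).
exists (\sum_(a < m.+1) cl a * cr (m - a)%N).
  by apply: sumr_ge0 => a _; rewrite mulr_ge0.
move=> [q p] xP; rewrite interactionE //; move: xP => [/= qP pP].
apply: le_trans (normc_sum _ _ _) _; rewrite mulr_suml; apply: ler_sum => a _.
rewrite normcM normcX normcN normc1 expr1n mul1r normcM mulrACA.
apply: ler_pM; rewrite ?normc_ge0 //.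
  by apply: cl_le; [case: qP => ->; rewrite size_left|exact: inc_nat_pos qP].
by apply: cr_le; [case: pP => ->; rewrite size_right|exact: inc_nat_pos pP].
Qed.

Lemma esum_wt_pair (c : R) d (l : int) : 0 <= c -> (0 < d)%N ->
  (\esum_(N in setT) (c * (wt d (absz N).+1 + wt d (absz (N - l)%R).+1))%:E
   = (c * (psum setT (fun N : int => wt d (absz N).+1) *+ 2))%:E)%E.
Proof.
move=> c0 d0; have ws := @psummable_wt_int R d d0.
have w0 : nonneg_on setT (fun N : int => wt d (absz N).+1 : R).
  by move=> N _; exact: wt_ge0.
rewrite esumZ_fin // esumD_fin //; last by move=> N _; exact: wt_ge0.
rewrite -(reindex_esum _ _ _ (fun N : int => (wt d (absz N).+1 : R)%:E) (shift_bij l)).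
by rewrite psumE // mulr2n.
Qed.

(** Up to a constant, the compensated simple pole is at most
l / ((|N| + 1) (|N - l| + 1)), where l is the largest distance on the left. The
factor l lowers the exponent of that distance, which is at least 2, to at
least 1, and [kernel_bound] applies. *)
Lemma csummable_interaction_gap j m : (j < r)%N ->
  csummable (sides j `*` setT)
    (fun x => interaction j m x.1 * gap s (last 0%N x.1.1) x.2).
Proof.
move=> jr; have [c1 c10 c1_le] := interaction_bound m jr.
have [c2 c20 c2_le] := inv_shift_bound sZ.
pose E : R := psum setT (fun N : int => wt j.+1 (absz N).+1).
pose dr := (size (drop j.+1 k)).+1.
pose W (x : seq nat * seq nat) : R :=
  (\prod_(a <- x.1) wt j.+1 a) * \prod_(a <- x.2) wt dr a.
have prod_wt0 d (q : seq nat) : 0 <= \prod_(a <- q) wt d.+1 a :> R.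
  by apply: prodr_ge0 => a _; exact: wt_ge0.
have W0 x : 0 <= W x by rewrite mulr_ge0 ?prod_wt0.
have Wsum : psummable (sides j) W.
  have := @psummableM R _ _ (inc_nat j) (inc_nat (r - j.+1))
    (fun q => \prod_(a <- q) wt j.+1 a) (fun p => \prod_(a <- p) wt dr a).
  apply.
  - by move=> q _; exact: prod_wt0.
  - by move=> p _; exact: prod_wt0.
  - exact: psummable_inc_nat_wt.
  - exact: psummable_inc_nat_wt.
pose c := c1 * c2 ^+ 2 * 2.
have c0 : 0 <= c by rewrite !mulr_ge0 // ltW.
apply: (@psummable_prod_bound R _ _ (sides j) setT
  (fun x => normc (interaction j m x.1 * gap s (last 0%N x.1.1) x.2))
  _ (fun x => (c * (E *+ 2)) * W x)).
- by move=> x _; exact: normc_ge0.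
- by move=> x _; rewrite mulr_ge0 // mulr_ge0 // mulrn_wge0 // psum_ge0 // => N _; exact: wt_ge0.
- apply: psummableZ => //; rewrite mulr_ge0 // mulrn_wge0 // psum_ge0 // => N _; exact: wt_ge0.
move=> [q p] xP; have [qP pP] := xP; rewrite /= in qP pP *.
have -> : c * (E *+ 2) * W (q, p) = (c * W (q, p)) * (E *+ 2) by rewrite mulrAC.
rewrite -(esum_wt_pair (last 0%N q)%:Z) //; last by rewrite mulr_ge0.
apply: le_esum => N _; rewrite lee_fin normcM.
apply: le_trans (ler_pM _ _ (c1_le _ xP) (normc_gap sZ (last 0%N q) N c20 c2_le)) _;
  rewrite ?normc_ge0 //=.
set x := (absz N).+1; set y := (absz _).+1; set l := last 0%N q.
have [q1 p1] := (inc_nat_pos qP, inc_nat_pos pP).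
have ql : zpow (rev (take j k)) q * l%:R <= \prod_(a <- q) a%:R^-1 :> R.
  apply: zpow_last_le => //; first exact: admissible_left.
  by case: qP => ->; rewrite size_left.
have pw : zpow (drop j.+1 k) p <= \prod_(a <- p) wt dr a :> R.
  apply: zpow_le_wt; first exact: admissible_right.
  by rewrite size_right.
have sq : size q = j by case: qP.
have xyl : (l <= x + y)%N by rewrite /x /y; lia.
have ql' : all (geq l) q by case: qP => _ /path_le_last /andP[].
have := @kernel_bound R x y l q isT isT xyl ql'; rewrite sq => ker.
have P0 : 0 <= \prod_(a <- q) a%:R^-1 :> R by apply: prodr_ge0 => a _; rewrite invr_ge0.
have xy0 : 0 <= (x%:R * y%:R)^-1 :> R by rewrite invr_ge0 mulr_ge0.
rewrite [leLHS](_ : _ = c1 * c2 ^+ 2 * (((x%:R * y%:R)^-1 *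
  (zpow (rev (take j k)) q * l%:R)) * zpow (drop j.+1 k) p)); last by ring.
rewrite [leRHS](_ : _ = c1 * c2 ^+ 2 * ((2 * (wt j.+1 x + wt j.+1 y) *
  \prod_(a <- q) wt j.+1 a) * \prod_(a <- p) wt dr a)); last first.
  by rewrite /c /W /=; ring.
apply: ler_wpM2l; first by rewrite mulr_ge0 // exprn_ge0 // ltW.
apply: ler_pM => //; last 1 first.
- by apply: le_trans ker; rewrite ler_wpM2l.
- by rewrite mulr_ge0 // mulr_ge0 // zpow_ge0.
- exact: zpow_ge0.
Qed.

Lemma csum_interaction_gap j m : (j < r)%N ->
  csum (sides j `*` setT)
    (fun x => interaction j m x.1 * gap s (last 0%N x.1.1) x.2) = 0.
Proof.
move=> jr; rewrite csum_iter; last exact: csummable_interaction_gap.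
rewrite -[RHS](csum0 (sides j)); apply: eq_csum => x _ /=.
by have [gs g0] := csum_gap sZ (last 0%N x.1); rewrite csumZ // g0 mulr0.
Qed.

Lemma multitangent1 e : multitangent [:: e] s = csum setT (fun N : int => (N%:~R + s) ^- e).
Proof.
have b : set_bij [set: int] [set n : (size [:: e]).-tuple int | sorted <%R n]
    (fun N : int => [tuple N]).
  split=> [//|N N' _ _ [//]|n _].
  exists (tnth n ord0) => //; apply: eq_from_tnth => i.
  by have -> : i = ord0 by apply/val_inj; case: i => -[].
rewrite /multitangent (csum_reindex _ b); apply: eq_csum => N _ /=.
by rewrite big_ord1.
Qed.

Lemma multitangentE : multitangent k s =
  csum (inc_int r) (fun n => \prod_(i < r) node n i ^- nth 0%N k i).
Proof.
rewrite (csum_reindex _ (inc_int_bij r)); apply: eq_csum => n _ /=.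
by apply: eq_bigr => i _; rewrite /node (tnth_nth 0).
Qed.

Let pole (n : seq int) (j : 'I_r) m := local_coef (node n) M exponents j m.
Let first_pos : 'I_r := Ordinal size_gt0.

(** The principal part at the j-th entry, with its simple pole compensated by
the first entry, whose distance to the j-th one is the largest on the left. *)
Definition contribution (j : 'I_r) (n : seq int) : C :=
  \sum_(m < (nth 0%N k j).-1) node n j ^- (nth 0%N k j - m) * pole n j m
  + pole n j (nth 0%N k j).-1 * ((node n j)^-1 - (node n first_pos)^-1).

Lemma nth_k_gt0 (j : 'I_r) : (0 < nth 0%N k j)%N.
Proof. exact: (all_nthP 0%N k_index). Qed.

Lemma prod_contribution n : inc_int r n ->
  \prod_(i < r) node n i ^- nth 0%N k i = \sum_j contribution j n.
Proof.
move=> nP; have := @prod_partial_fractions_regular _ _ (node n) M (node_inj nP) exponents.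
move=> /(_ _ _ first_pos _ _) E.
under eq_bigr do rewrite -[X in _ ^- X](ffunE (fun i : 'I_r => nth 0%N k i)).
rewrite {}E //.
- by apply: eq_bigr => j _; rewrite /contribution ffunE.
- by move=> j; rewrite ffunE nth_k_gt0.
- by move=> j; rewrite ffunE nth_le_M.
- by move=> i; exact: shift_neq0.
rewrite (bigD1 first_pos) //= ffunE /= nth0; apply: leq_trans k_first _.
exact: leq_addr.
Qed.

Lemma contribution_unfold (j : 'I_r) x : (sides j `*` setT) x ->
  contribution j (unfold_at x) =
  \sum_(m < (nth 0%N k j).-1) interaction j m x.1 * (x.2%:~R + s) ^- (nth 0%N k j - m)
  + interaction j (nth 0%N k j).-1 x.1 * gap s (last 0%N x.1.1) x.2.
Proof.
move=> xP; rewrite /contribution /pole local_coef_unfold //.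
have [[[qj _] _] _] := xP; case: x xP qj => [[q p] N] xP /= qj.
have Nj : node (unfold_at ((q, p), N)) j = N%:~R + s.
  by rewrite /node /unfold_at nth_cat size_rev size_map qj ltnn subnn.
have N0 : node (unfold_at ((q, p), N)) first_pos = (N - (last 0%N q)%:Z)%:~R + s.
  rewrite /node /unfold_at /=; case/lastP: {xP qj Nj}q => [|q z] /=.
    by rewrite subr0.
  by rewrite map_rcons rev_rcons last_rcons.
rewrite Nj N0 -/(gap s _ _); congr (_ + _); apply: eq_bigr => m _.
by rewrite local_coef_unfold // mulrC.
Qed.

Lemma csum_contribution (j : 'I_r) : csummable (inc_int r) (contribution j) /\
  csum (inc_int r) (contribution j) =
    \sum_(m < (nth 0%N k j).-1)
      tangent_coef 0 k j m * multitangent [:: (nth 0%N k j - m)%N] s.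
Proof.
have ub := unfold_at_bij (ltn_ord j); rewrite -/(sides j) in ub.
have kj := nth_k_gt0 j; have kjM := nth_le_M j.
have term (m : 'I_(nth 0%N k j).-1) :
  let f := fun x : (seq nat * seq nat) * int =>
    interaction j m x.1 * (x.2%:~R + s) ^- (nth 0%N k j - m) in
  csummable (sides j `*` setT) f /\ csum (sides j `*` setT) f =
    tangent_coef 0 k j m * multitangent [:: (nth 0%N k j - m)%N] s.
  have mM : (m < M)%N by have := ltn_ord m; lia.
  have [ims ie] := csum_interaction 0 (ltn_ord j) mM.
  rewrite -ie multitangent1; apply: csum_mul => //; apply: csummable_pow => //.
  by have := ltn_ord m; lia.
have main_s : csummable (sides j `*` setT) (fun x : (seq nat * seq nat) * int =>
    \sum_(m < (nth 0%N k j).-1) interaction j m x.1 * (x.2%:~R + s) ^- (nth 0%N k j - m)).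
  by apply: csummable_sum => m _; have [] := term m.
have gap_s := csummable_interaction_gap (nth 0%N k j).-1 (ltn_ord j).
split.
  apply: (proj2 (csummable_reindex _ ub)).
  by apply: eq_csummable (fun x => @contribution_unfold j x) _; exact: csummableD.
rewrite (csum_reindex _ ub) (eq_csum (fun x => @contribution_unfold j x)).
rewrite csumD // csum_interaction_gap // addr0 csum_sum => [|m _]; last by have [] := term m.
by apply: eq_bigr => m _; have [] := term m.
Qed.

Theorem multitangent_reduction : multitangent k s =
  \sum_(j < size k) \sum_(m < (nth 0%N k j).-1)
    tangent_coef 0 k j m * multitangent [:: (nth 0%N k j - m)%N] s.
Proof.
rewrite multitangentE (eq_csum prod_contribution) csum_sum => [|j _].
  by apply: eq_bigr => j _; have [_ ->] := csum_contribution j.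
by have [] := csum_contribution j.
Qed.

End AtPoint.

Lemma tangent_coef_const (T : C) j m : (j < r)%N -> (m < (nth 0%N k j).-1)%N ->
  tangent_coef T k j m = tangent_coef 0 k j m.
Proof.
move=> jr mk; have mM : (m < M)%N by have := nth_le_M j; lia.
by have [_ <-] := csum_interaction T jr mM; have [_ <-] := csum_interaction 0 jr mM.
Qed.

End Assembly.

Theorem corollary6p7 (R : realType) (k : seq nat) (hk : is_index k)
    (hfirst : (2 <= head 0 k)%N) (hlast : (2 <= last 0 k)%N) :
  (forall s : R[i], (forall n : int, s <> n%:~R) ->
     multitangent k s =
       \sum_(j < size k) \sum_(m < (nth 0%N k j).-1)
         tangent_coef 0 k j m * multitangent [:: (nth 0%N k j - m)%N] s)
  /\
  (forall (j m a b : nat) (w : seq nat),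
     (j < size k)%N -> (m < (nth 0%N k j).-1)%N -> (a + b = m)%N ->
     occurs_in_shift a (rev (take j k)) w \/ occurs_in_shift b (drop j.+1 k) w ->
     admissible w /\ @mzv_convergent R w)
  /\
  (forall (T : R[i]) (j m : nat),
     (j < size k)%N -> (m < (nth 0%N k j).-1)%N ->
     tangent_coef T k j m = tangent_coef 0 k j m).
Proof.
split; first by move=> s sZ; exact: multitangent_reduction.
split; last by move=> T j m; exact: tangent_coef_const.
move=> j m a b w _ _ _ occ; suff wa : admissible w.
  by split=> //; exact: mzv_convergent_admissible.
case: occ => -[lam _ ->]; apply: admissible_shift.
  exact: admissible_left.
exact: admissible_right.
Qed.
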